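(* Let $m,n\geq 1$. The bigraded path homology of the bi-directed cycle $C_{m,n}$ depends only on $\mathfrak m=\max(m,n)$. More precisely, choose the shorter of the two directed intervals of $C_{m,n}$ (or either one if $m=n$), and contract all of its edges except the last, to obtain a map $C_{m,n}\to C_{\mathfrak m,1}$. This map induces an isomorphism on bigraded path homology.
   Context: Fix a commutative ground ring $R$. A directed graph $G$ has a vertex set $V(G)$ and edge set $E(G)\subseteq V(G)\times V(G)$ (no parallel edges). A map of directed graphs $G\to H$ is a function $f\colon V(G)\to V(H)$ such that for each edge $x\to y$ of $G$ either $f(x)=f(y)$ or $f(x)\to f(y)$ is an edge of $H$. The distance $d(x,y)\in\{0,1,\dots,\infty\}$ is the minimal number of edges in a directed path from $x$ to $y$. The bi-directed cycle $C_{m,n}$ ($m,n\geq1$) is obtained from a directed interval with $m$ edges and a directed interval with $n$ edges by identifying their initial vertices to a single vertex and their final vertices to a single vertex. The reachability complex $\mathrm{RC}_*(G)$ has in degree $k$ the free $R$-module on tuples $(x_0,\dots,x_k)$ of vertices with consecutive entries distinct and $d(x_i,x_{i+1})<\infty$ for all $i$; its differential is $\sum_{i=0}^k(-1)^i(x_0,\dots,\widehat{x_i},\dots,x_k)$, omitting terms with repeated consecutive entries. The length of a tuple is $\ell(x_0,\dots,x_k)=\sum_i d(x_i,x_{i+1})$, and $F_\ell\mathrm{RC}_*(G)$ is spanned by tuples of length at most $\ell$. The magnitude-path spectral sequence $\{E^r_{*,*}(G),d^r\}_{r\geq0}$ is the spectral sequence of this filtered complex, with $E^0_{i,j}(G)=F_i\mathrm{RC}_{i+j}(G)/F_{i-1}\mathrm{RC}_{i+j}(G)$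 and $d^r$ of bidegree $(-r,r-1)$. Bigraded path homology is $\mathrm{PH}_{k,\ell}(G)=E^2_{\ell,k-\ell}(G)$; it is functorial for maps of directed graphs. *)

(* Defs.v *)
From HB Require Import structures.
From mathcomp Require Import all_boot all_order all_algebra.
From mathcomp Require Import finmap generic_quotient ring_quotient boolp.
From mathcomp.multinomials Require Import monalg.

Set Implicit Arguments.
Unset Strict Implicit.
Unset Printing Implicit Defensive.

Import Order.TTheory GRing.Theory Num.Theory.

Local Open Scope ring_scope.
Local Open Scope quotient_scope.

Record submodule (R : pzRingType) (V : lmodType R) := Submodule {
  submod_mem :> {pred V};
  submodP : submod_closed submod_mem
}.
HB.instance Definition _ (R : pzRingType) (V : lmodType R) (Z : submodule V) :=
  GRing.isSubmodClosed.Build R V (submod_mem Z) (submodP Z).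

Section Subquotient.
Variables (R : pzRingType) (V : lmodType R) (Z B : submodule V).

Record subm := Subm { subm_val : V; _ : subm_val \in Z }.
HB.instance Definition _ := [isSub for subm_val].
HB.instance Definition _ := [Choice of subm by <:].
HB.instance Definition _ := [SubChoice_isSubLmodule of subm by <:].

(* The quotient is Z / (B :&: Z); membership in B is all that is tested, so
   this is the subquotient Z / B whenever B is contained in Z. *)
Definition subm_trace : {pred subm} := fun x => subm_val x \in B.

Fact subm_trace_closed : zmod_closed subm_trace.
Proof.
split=> [|x y]; rewrite ![_ \in subm_trace]unfold_in /subm_trace /=.
  exact: rpred0.
move=> hx hy; change (\val (x - y) \in B).
by rewrite raddfB rpredB.
Qed.
HB.instance Definition _ :=
  GRing.isZmodClosed.Build _ subm_trace subm_trace_closed.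

Definition subq := Quotient.quot subm_trace.
HB.instance Definition _ := EqQuotient.on subq.
HB.instance Definition _ := Choice.on subq.
HB.instance Definition _ := GRing.Zmodule.on subq.

Definition subq_pi (x : subm) : subq := \pi_(Quotient.quot subm_trace) x.

Lemma subq_piE (x y : subm) :
  (subq_pi x = subq_pi y) <-> (subm_val x - subm_val y \in B).
Proof.
have E : (x - y \in subm_trace) = (subm_val x - subm_val y \in B).
  by change ((\val (x - y) \in B) = (\val x - \val y \in B)); rewrite raddfB.
by rewrite -E; split=> [/eqmodP|h] //; apply/eqmodP.
Qed.

Fact subq_pi_zmod : zmod_morphism subq_pi.
Proof. exact: pi_is_zmod_morphism. Qed.
HB.instance Definition _ := GRing.isZmodMorphism.Build subm subq subq_pi
  subq_pi_zmod.

Lemma subq_reprK (q : subq) : subq_pi (repr q) = q.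
Proof. exact: reprK. Qed.

Definition subq_scale (a : R) (q : subq) : subq := subq_pi (a *: repr q).

Lemma subq_scaleE a x : subq_scale a (subq_pi x) = subq_pi (a *: x).
Proof.
apply/subq_piE; rewrite -[_ - _]/(a *: _ - a *: _) -scalerBr rpredZ //.
exact/subq_piE/subq_reprK.
Qed.

Fact subq_scalerA a b q : subq_scale a (subq_scale b q) = subq_scale (a * b) q.
Proof. by rewrite -(subq_reprK q) !subq_scaleE scalerA. Qed.
Fact subq_scale1r : left_id 1 subq_scale.
Proof. by move=> q; rewrite -(subq_reprK q) subq_scaleE scale1r. Qed.
Fact subq_scalerDr : right_distributive subq_scale +%R.
Proof.
move=> a p q; rewrite -(subq_reprK p) -(subq_reprK q) -raddfD !subq_scaleE.
by rewrite scalerDr raddfD.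
Qed.
Fact subq_scalerDl q : {morph subq_scale^~ q : a b / a + b}.
Proof.
by move=> a b; rewrite -(subq_reprK q) !subq_scaleE scalerDl raddfD.
Qed.
HB.instance Definition _ := GRing.Zmodule_isLmodule.Build R subq
  subq_scalerA subq_scale1r subq_scalerDr subq_scalerDl.

Fact subq_pi_scalable : scalable subq_pi.
Proof. by move=> a x; rewrite -subq_scaleE. Qed.
HB.instance Definition _ := GRing.isScalable.Build R subm subq *:%R subq_pi
  subq_pi_scalable.
End Subquotient.

Section SubquotientMap.
Variables (R : pzRingType) (V V' : lmodType R) (f : {linear V -> V'}).
Variables (Z B : submodule V) (Z' B' : submodule V').
Hypothesis fZ : forall x, x \in Z -> f x \in Z'.
Hypothesis fB : forall x, x \in B -> f x \in B'.

Definition subm_map (x : subm Z) : subm Z' := Subm (fZ (valP x)).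

Definition subq_map of (forall x, x \in B -> f x \in B') :=
  fun q : subq Z B => subq_pi B' (subm_map (repr q)).

Lemma subq_mapE x : subq_map fB (subq_pi B x) = subq_pi B' (subm_map x).
Proof.
apply/subq_piE; rewrite /= -raddfB fB //.
exact/subq_piE/subq_reprK.
Qed.

Fact subq_map_is_linear : linear (subq_map fB).
Proof.
move=> a p q; rewrite -(subq_reprK p) -(subq_reprK q) -linearP !subq_mapE.
rewrite -linearP; congr (subq_pi _ _); apply: val_inj.
change (f (\val (a *: repr p + repr q))
  = \val (a *: subm_map (repr p) + subm_map (repr q))).
by rewrite !linearP.
Qed.
HB.instance Definition _ := GRing.isLinear.Build R (subq Z B) (subq Z' B') *:%R
  (subq_map fB) subq_map_is_linear.
End SubquotientMap.

(* A graded module is kept as one ambient module: [fc_fil p n] is the degree-n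
   part of the p-th filtration step. *)
Record filtered_complex (R : pzRingType) := FilteredComplex {
  fc_total : lmodType R;
  fc_d : {linear fc_total -> fc_total};
  fc_fil : int -> int -> submodule fc_total;
  fc_fil_le : forall p n x, x \in fc_fil p n -> x \in fc_fil (p + 1) n;
  fc_d_fil : forall p n x, x \in fc_fil p n -> fc_d x \in fc_fil p (n - 1);
  fc_dd : forall x, fc_d (fc_d x) = 0
}.

Section Pages.
Variables (R : pzRingType) (C : filtered_complex R).
Implicit Types (r p n : int) (x y z : fc_total C).
Local Notation d := (@fc_d R C).
Local Notation F := (@fc_fil R C).

(* The spectral sequence of a filtered complex C, with C_n in total degree n:
     Z^r_p = {x in F_p C_n | d x in F_(p-r) C_(n-1)},
     E^r_(p,n-p) = Z^r_p / (Z^(r-1)_(p-1) + d Z^(r-1)_(p+r-1)).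
   The index r is an integer so that r - 1 makes sense for r = 0. *)
Definition ss_cycle_mem r p n : {pred fc_total C} :=
  fun x => (x \in F p n) && (d x \in F (p - r) (n - 1)).

Fact ss_cycle_closed r p n : submod_closed (ss_cycle_mem r p n).
Proof.
split=> [|a x y]; rewrite ![_ \in ss_cycle_mem _ _ _]unfold_in /ss_cycle_mem.
  by rewrite linear0 !rpred0.
by move=> /andP[x1 x2] /andP[y1 y2]; rewrite linearP !rpredD ?rpredZ.
Qed.
Definition ss_cycle r p n := Submodule (ss_cycle_closed r p n).

Definition ss_bound_mem r p n : {pred fc_total C} := fun x =>
  `[< exists y z, [/\ y \in ss_cycle (r - 1) (p - 1) n,
        z \in ss_cycle (r - 1) (p + r - 1) (n + 1) & x = y + d z] >].

Fact ss_bound_closed r p n : submod_closed (ss_bound_mem r p n).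
Proof.
split=> [|a x y]; rewrite ![_ \in ss_bound_mem _ _ _]unfold_in /ss_bound_mem.
  by apply/asboolP; exists 0, 0; rewrite !rpred0 linear0 addr0.
move=> /asboolP[y1 [z1 [hy1 hz1 ->]]] /asboolP[y2 [z2 [hy2 hz2 ->]]].
apply/asboolP; exists (a *: y1 + y2), (a *: z1 + z2).
by rewrite !rpredD ?rpredZ // linearP scalerDr addrACA.
Qed.
Definition ss_bound r p n := Submodule (ss_bound_closed r p n).

Lemma ss_cycle0 p n x : (x \in ss_cycle 0 p n) = (x \in F p n).
Proof.
rewrite [LHS]unfold_in /= /ss_cycle_mem subr0.
by case: (boolP (x \in F p n)) => // /fc_d_fil ->.
Qed.

Lemma ss_bound0 p n x : (x \in ss_bound 0 p n) = (x \in F (p - 1) n).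
Proof.
rewrite [LHS]unfold_in /= /ss_bound_mem sub0r addr0.
have sub1 y q k : y \in ss_cycle (- 1) q k = (y \in F q k).
  rewrite unfold_in /= /ss_cycle_mem opprK.
  by case: (boolP (y \in F q k)) => // /fc_d_fil /fc_fil_le ->.
apply/asboolP/idP => [[y [z [+ + ->]]]|xF]; last first.
  by exists x, 0; rewrite !sub1 xF rpred0 linear0 addr0.
by rewrite !sub1 => yF /fc_d_fil; rewrite addrK => zF; rewrite rpredD.
Qed.

Lemma ss_bound_cycle r p n x : 0 <= r ->
  x \in ss_bound r p n -> x \in ss_cycle r p n.
Proof.
have le q q' k y : q <= q' -> y \in F q k -> y \in F q' k.
  rewrite -subr_ge0 => h yF; rewrite -[q'](subrK q) addrC.
  case: (q' - q) h => // a _; elim: a => [|a IH]; first by rewrite addr0.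
  by rewrite -addn1 PoszD addrA fc_fil_le.
move=> r0; rewrite [_ \in ss_bound _ _ _]unfold_in /= /ss_bound_mem.
case/asboolP=> y [z [+ + ->]].
rewrite ![_ \in ss_cycle _ _ _]unfold_in /= /ss_cycle_mem.
case/andP=> y1 y2 /andP[_ z2]; rewrite linearD /= fc_dd addr0.
move: y2 z2; rewrite !opprB !addrA !subrK !addrK => y2 z2.
by rewrite rpredD // ?y2 ?z2 // (le _ _ _ _ _ y1) // gerBl.
Qed.

Definition ss_page (r : nat) (i j : int) : lmodType R :=
  subq (ss_cycle r%:Z i (i + j)) (ss_bound r%:Z i (i + j)).

End Pages.

Record filtered_map (R : pzRingType) (C C' : filtered_complex R) := FilteredMap {
  fc_map : {linear fc_total C -> fc_total C'};
  fc_map_d : forall x, fc_d C' (fc_map x) = fc_map (fc_d C x);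
  fc_map_fil : forall p n x, x \in fc_fil C p n -> fc_map x \in fc_fil C' p n
}.

Section PageMap.
Variables (R : pzRingType) (C C' : filtered_complex R) (f : filtered_map C C').

Lemma fc_map_cycle r p n x :
  x \in ss_cycle C r p n -> fc_map f x \in ss_cycle C' r p n.
Proof.
rewrite ![_ \in ss_cycle _ _ _ _]unfold_in /= /ss_cycle_mem fc_map_d.
by case/andP=> h1 h2; rewrite !fc_map_fil.
Qed.

Lemma fc_map_bound r p n x :
  x \in ss_bound C r p n -> fc_map f x \in ss_bound C' r p n.
Proof.
rewrite ![_ \in ss_bound _ _ _ _]unfold_in /= /ss_bound_mem.
case/asboolP=> y [z [hy hz ->]]; apply/asboolP.
exists (fc_map f y), (fc_map f z).
by rewrite !fc_map_cycle // linearD /= fc_map_d.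
Qed.

Definition ss_page_map (r : nat) (i j : int) :
    {linear ss_page C r i j -> ss_page C' r i j} :=
  subq_map (@fc_map_cycle r%:Z i (i + j)) (@fc_map_bound r%:Z i (i + j)).
End PageMap.

(* The multinomials library gives {malg R[K]} a module structure only for a
   nontrivial ring R, hence this copy. *)
Definition freemod (R : pzRingType) (K : choiceType) := {malg R[K]}.

Section FreeModule.
Variables (R : pzRingType) (K : choiceType).
Local Notation FM := (freemod R K).

HB.instance Definition _ := GRing.Zmodule.on FM.

Definition freemod_scale (c : R) (g : FM) : FM := [malg k in msupp g => c * g@_k].

Lemma freemod_scaleE c g k : (freemod_scale c g)@_k = c * g@_k.
Proof.
rewrite mcoeffE; case: ifPn => // /mcoeff_outdom ->.
by rewrite mulr0.
Qed.

Fact freemod_scalerA a b g :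
  freemod_scale a (freemod_scale b g) = freemod_scale (a * b) g.
Proof. by apply/malgP=> k; rewrite !freemod_scaleE mulrA. Qed.
Fact freemod_scale1r : left_id 1 freemod_scale.
Proof. by move=> g; apply/malgP=> k; rewrite freemod_scaleE mul1r. Qed.
Fact freemod_scalerDr : right_distributive freemod_scale +%R.
Proof.
by move=> a g h; apply/malgP=> k; rewrite !(freemod_scaleE, mcoeffD) mulrDr.
Qed.
Fact freemod_scalerDl g : {morph freemod_scale^~ g : a b / a + b}.
Proof.
by move=> a b; apply/malgP=> k; rewrite !(freemod_scaleE, mcoeffD) mulrDl.
Qed.
HB.instance Definition _ := GRing.Zmodule_isLmodule.Build R FM
  freemod_scalerA freemod_scale1r freemod_scalerDr freemod_scalerDl.

Lemma mcoeff_freemodZ c (g : FM) k : (c *: g)@_k = c * g@_k.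
Proof. exact: freemod_scaleE. Qed.

Definition freemod_gen (k : K) : FM := << 1 *g k >>.

Lemma freemod_sumE (g : FM) : g = \sum_(k <- msupp g) g@_k *: freemod_gen k.
Proof.
rewrite {1}(monalgE g); apply: eq_bigr => k _; apply/malgP => k'.
by rewrite mcoeff_freemodZ !mcoeffU mulrnAr mulr1.
Qed.

Lemma freemod_lin_ext (M : lmodType R) (f h : {linear FM -> M}) :
  (forall k, f (freemod_gen k) = h (freemod_gen k)) -> forall g, f g = h g.
Proof.
move=> fh g; rewrite (freemod_sumE g) !linear_sum; apply: eq_bigr => k _.
by rewrite !linearZ fh.
Qed.

Section Lift.
Variables (M : lmodType R) (f : K -> M).

Definition freemod_lift (g : FM) : M := \sum_(k <- msupp g) g@_k *: f k.

Lemma freemod_liftEw (D : {fset K}) (g : FM) : (msupp g `<=` D)%fset ->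
  freemod_lift g = \sum_(k <- D) g@_k *: f k.
Proof.
move=> sD; apply: big_fset_incl => // k _ /mcoeff_outdom ->.
by rewrite scale0r.
Qed.

Fact freemod_lift_is_linear : linear freemod_lift.
Proof.
move=> a g h; pose D := (msupp g `|` msupp h `|` msupp (a *: g + h))%fset.
have [sg sh sgh] : [/\ (msupp g `<=` D)%fset, (msupp h `<=` D)%fset
    & (msupp (a *: g + h) `<=` D)%fset].
  by split; apply/fsubsetP=> k hk; rewrite !inE hk ?orbT.
rewrite !(freemod_liftEw sg, freemod_liftEw sh, freemod_liftEw sgh).
rewrite scaler_sumr -big_split; apply: eq_bigr => k _ /=.
by rewrite mcoeffD mcoeff_freemodZ scalerDl scalerA.
Qed.
HB.instance Definition _ := GRing.isLinear.Build R FM M *:%R freemod_lift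
  freemod_lift_is_linear.

Lemma freemod_lift_gen k : freemod_lift (freemod_gen k) = f k.
Proof.
rewrite (@freemod_liftEw [fset k]%fset) ?msuppU_le //.
by rewrite big_seq_fset1 mcoeffUU scale1r.
Qed.
End Lift.

Definition supported_mem (P : pred K) : {pred FM} := fun g => all P (msupp g).

Fact supported_closed P : submod_closed (supported_mem P).
Proof.
split=> [|a g h]; rewrite ![_ \in supported_mem _]unfold_in /supported_mem.
  by rewrite msupp0.
move=> /allP Pg /allP Ph; apply/allP => k.
rewrite -mcoeff_neq0 mcoeffD mcoeff_freemodZ.
have [/Pg //|kg] := boolP (k \in msupp g).
have [/Ph //|kh] := boolP (k \in msupp h).
by rewrite !mcoeff_outdom // mulr0 addr0 eqxx.
Qed.
Definition supported (P : pred K) := Submodule (supported_closed P).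

End FreeModule.

Record digraph := Digraph { vertex :> choiceType; edge : rel vertex }.

Record digraph_map (G H : digraph) := DigraphMap {
  dmap :> G -> H;
  dmapP : forall x y, edge x y -> dmap x = dmap y \/ edge (dmap x) (dmap y)
}.

Section Distance.
Variable G : digraph.
Implicit Types (x y z : G) (s t : seq G).

Definition walk x y (n : nat) : bool :=
  `[< exists p : seq G, [/\ path (@edge G) x p, last x p = y & size p = n] >].

(* [None] stands for an infinite distance. *)
Definition distance x y : option nat :=
  match pselect (exists n, walk x y n) with
  | left ex => Some (ex_minn ex)
  | right _ => None
  end.

Definition reach x y : bool := distance x y != None.

Definition dist x y : nat := odflt 0 (distance x y).

Lemma walk0 x : walk x x 0.
Proof. by apply/asboolP; exists [::]. Qed.

Lemma walk_cat x y z m n : walk x y m -> walk y z n -> walk x z (m + n)%N.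
Proof.
move=> /asboolP[p [hp lp <-]] /asboolP[q [hq lq <-]]; apply/asboolP.
by exists (p ++ q); rewrite cat_path last_cat lp hp size_cat.
Qed.

Lemma walk_reach x y n : walk x y n -> reach x y /\ (dist x y <= n)%N.
Proof.
move=> w; rewrite /reach /dist /distance; case: pselect => [ex|[]]; last by exists n.
by split=> //=; case: ex_minnP => m _; apply.
Qed.

Lemma reach_walk x y : reach x y -> walk x y (dist x y).
Proof.
by rewrite /reach /dist /distance; case: pselect => //= ex _; case: ex_minnP.
Qed.

Lemma reachxx x : reach x x.
Proof. by case: (walk_reach (walk0 x)). Qed.

Lemma reach_dist_trans y x z : reach x y -> reach y z ->
  reach x z /\ (dist x z <= dist x y + dist y z)%N.
Proof. by move=> /reach_walk h1 /reach_walk h2; apply/walk_reach/walk_cat/h2. Qed.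

Lemma reach_trans : transitive reach.
Proof. by move=> y x z h1 h2; case: (reach_dist_trans h1 h2). Qed.

(* A tuple (x_0, ..., x_k) is the sequence of its k + 1 entries. *)
Definition rc_gen_pred : pred (seq G) :=
  fun s => (s != [::]) && sorted (fun x y => (x != y) && reach x y) s.

Record rc_gen := RCGen { rc_tuple :> seq G; _ : rc_gen_pred rc_tuple }.
HB.instance Definition _ := [isSub for rc_tuple].
HB.instance Definition _ := [Choice of rc_gen by <:].

(* All distances met on a generator are finite. *)
Definition tuple_length s : nat :=
  if s is x :: s' then sumn (pairmap dist x s') else 0.

Definition face (i : nat) s : seq G := take i s ++ drop i.+1 s.

Lemma rc_gen_reach (g : rc_gen) : sorted reach g.
Proof.
case: g => -[//|x s] /= /andP[_]; apply: sub_path => a b.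
by case/andP.
Qed.

Lemma subseq_face i s : subseq (face i s) s.
Proof.
rewrite -{2}(cat_take_drop i s) cat_subseq //.
by rewrite -addn1 addnC -drop_drop drop_subseq.
Qed.

Lemma face_reach i s : sorted reach s -> sorted reach (face i s).
Proof. exact/subseq_sorted/subseq_face/reach_trans. Qed.

Lemma size_face i s : (i < size s)%N -> size (face i s) = (size s).-1.
Proof.
move=> h; rewrite size_cat size_take h size_drop subnS addnC.
by rewrite -subn1 -[RHS]subn1 addnBAC ?subn_gt0 // subnK // ltnW.
Qed.

Lemma split_face i s : (i < size s)%N ->
  exists a x b, s = a ++ x :: b /\ size a = i.
Proof.
case: s => // x0 s h; exists (take i (x0 :: s)), (nth x0 (x0 :: s) i).
exists (drop i.+1 (x0 :: s)).
by rewrite -drop_nth // cat_take_drop size_takel // ltnW.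
Qed.

Lemma face_cat a x s : face (size a) (a ++ x :: s) = a ++ s.
Proof. by rewrite /face take_size_cat // drop_cat ltnNge leqnSn subSnn /= drop0. Qed.

Lemma face_catl i a b : (i < size a)%N -> face i (a ++ b) = face i a ++ b.
Proof.
by move=> /split_face[u [x [v [-> <-]]]]; rewrite -catA /= !face_cat catA.
Qed.

Lemma face_catr k a b : face (size a + k) (a ++ b) = a ++ face k b.
Proof.
rewrite /face take_cat ltnNge leq_addr /= drop_cat -addnS ltnNge leq_addr /=.
by rewrite !addKn catA.
Qed.

Lemma tuple_length_face i s : (i < size s)%N -> sorted reach s ->
  (tuple_length (face i s) <= tuple_length s)%N.
Proof.
move=> /split_face[a [x [b [-> <-]]]]; rewrite face_cat.
case: a => [|z a] /=.
  by case: b => //= y b _; rewrite leq_addl.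
elim: a z => [|y a IH] z /=; last first.
  by case/andP=> _ /IH h; rewrite leq_add2l.
case: b => [|y b] //= /and3P[zx xy _]; rewrite addnA leq_add2r.
by case: (reach_dist_trans zx xy).
Qed.

Lemma nongenP s : s != [::] -> sorted reach s -> ~~ rc_gen_pred s ->
  exists s1 x s2, s = s1 ++ x :: x :: s2.
Proof.
rewrite /rc_gen_pred => -> /=; elim: s => [|x [|y s] IH] //=.
case/andP=> rxy rs; rewrite rxy andbT negb_and negbK.
case/orP=> [/eqP <-|ns]; first by exists [::], x, s.
by have [s1 [z [s2 ->]]] := IH rs ns; exists (x :: s1), z, s2.
Qed.

Lemma face_swap i j s : (j < i < size s)%N ->
  face j (face i s) = face i.-1 (face j s).
Proof.
case/andP=> ji /split_face[u [y [c [-> ui]]]]; rewrite -ui in ji *.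
have [a [x [b [-> <-]]]] := split_face ji.
rewrite face_cat -!catA /= !face_cat size_cat addnS /= -size_cat !catA.
by rewrite face_cat.
Qed.
End Distance.

Lemma alternating_double_sum (R : pzRingType) (M : lmodType R) (n : nat)
    (F : nat -> nat -> M) :
  (forall i j, (j < i)%N -> (i < n.+1)%N -> F i j = F j i.-1) ->
  \sum_(i < n.+1) \sum_(j < n) (-1) ^+ (i + j) *: F i j = 0.
Proof.
move=> FE; pose T i j := (-1) ^+ (i + j) *: F i j.
have split_sum (i : 'I_n.+1) : \sum_(j < n) T i j
    = \sum_(j < n | (j < i)%N) T i j + \sum_(j < n | (i <= j)%N) T i j.
  rewrite (bigID (fun j : 'I_n => (j < i)%N)) /=; congr (_ + _).
  by apply: eq_bigl => j; rewrite -leqNgt.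
rewrite (eq_bigr _ (fun i _ => split_sum i)) big_split /=.
rewrite (exchange_big_dep xpredT) //= [X in _ + X]big_ord_recr /=.
rewrite [X in _ + (_ + X)]big1 ?addr0; last first.
  by move=> j; rewrite leqNgt ltn_ord.
rewrite -big_split big1 // => j _ /=.
rewrite big_mkcond big_ord_recl /= add0r -big_mkcond /=.
apply/eqP; rewrite addr_eq0 -sumrN; apply/eqP; apply: eq_big => // i ji.
by rewrite /T FE ?ltnS //= addSn exprS mulN1r scaleNr addnC.
Qed.

Section ReachabilityComplex.
Variables (R : comPzRingType).

Section Complex.
Variable G : digraph.
Local Notation RC := (freemod R (rc_gen G)).

(* On a face of a generator, [insub] fails exactly for a repetition of
   consecutive entries (reachability is transitive) and, in degree 0, for the
   empty sequence. *)
Definition rc_term (s : seq G) : RC :=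
  if insub s is Some g then freemod_gen R g else 0.

Definition rc_bd_gen (g : rc_gen G) : RC :=
  \sum_(i < size g) (-1) ^+ i *: rc_term (face i g).

Definition rc_bd : {linear RC -> RC} := freemod_lift rc_bd_gen.

Lemma rc_bd_genE g : rc_bd (freemod_gen R g) = rc_bd_gen g.
Proof. exact: freemod_lift_gen. Qed.

Definition rc_fil (p n : int) : submodule RC :=
  supported R (fun g : rc_gen G =>
    ((size g)%:Z == n + 1) && ((tuple_length g)%:Z <= p)).

Lemma rc_term_nongen s : ~~ rc_gen_pred s -> rc_term s = 0.
Proof. by move=> h; rewrite /rc_term insubF //; apply: negbTE. Qed.

Lemma rc_term_gen (g : rc_gen G) : rc_term g = freemod_gen R g.
Proof. by rewrite /rc_term valK. Qed.

Lemma rc_term_rep s1 x s2 : rc_term (s1 ++ x :: x :: s2) = 0.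
Proof.
rewrite rc_term_nongen // /rc_gen_pred negb_and; apply/orP; right.
by case: s1 => [|y s1] /=; rewrite ?cat_path /= eqxx //= !andbF.
Qed.

Lemma rc_bd_term s : sorted (@reach G) s ->
  rc_bd (rc_term s) = \sum_(i < size s) (-1) ^+ i *: rc_term (face i s).
Proof.
have [gs _|ngs rs] := boolP (rc_gen_pred s).
  by rewrite -[s]/(rc_tuple (RCGen gs)) rc_term_gen rc_bd_genE.
rewrite rc_term_nongen // linear0.
case: s ngs rs => [|y s] ngs rs; first by rewrite big_ord0.
have [s1 [x [s2 ->]]] := @nongenP _ (y :: s) isT rs ngs.
pose F i := (-1) ^+ i *: rc_term (face i (s1 ++ x :: x :: s2)).
rewrite -(big_mkord xpredT F) size_cat /= (@big_cat_nat _ _ _ (size s1)) //=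
  ?leq_addr //.
rewrite big_nat big1 ?add0r; last first.
  by move=> i /andP[_ hi]; rewrite /F face_catl // rc_term_rep scaler0.
have h1 : (size s1 < size s1 + (size s2).+2)%N by rewrite addnS ltnS leq_addr.
have h2 : ((size s1).+1 < size s1 + (size s2).+2)%N by rewrite !addnS !ltnS leq_addr.
rewrite (big_ltn h1) (big_ltn h2).
rewrite [X in _ + (_ + X)]big_nat [X in _ + (_ + X)]big1 ?addr0; last first.
  move=> i /andP[hi _]; rewrite /F -(subnKC hi) -addn2 -addnA add2n.
  by rewrite face_catr /face /= rc_term_rep scaler0.
rewrite /F face_cat -[in X in face X]addn1 face_catr /= exprS mulN1r scaleNr.
by rewrite /face /= drop0 subrr.
Qed.

Lemma rc_bd_bd x : rc_bd (rc_bd x) = 0.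
Proof.
apply: (@freemod_lin_ext _ _ _ (rc_bd \o rc_bd) (\0)) => g /=.
rewrite rc_bd_genE linear_sum /=.
have rg := rc_gen_reach g.
case sg: (size g) => [|n]; first by rewrite big_ord0.
pose F i j : RC := rc_term (face j (face i g)).
transitivity (\sum_(i < n.+1) \sum_(j < n) (-1) ^+ (i + j) *: F i j); last first.
  rewrite alternating_double_sum // => i j ji iN.
  by rewrite /F face_swap // ji sg.
apply: eq_bigr => i _; rewrite linearZ /= rc_bd_term ?face_reach //.
rewrite size_face ?sg //= scaler_sumr; apply: eq_bigr => j _.
by rewrite scalerA exprD.
Qed.

Lemma rc_fil_le p n x : x \in rc_fil p n -> x \in rc_fil (p + 1) n.
Proof.
move/allP=> h; apply/allP => g /h /andP[-> /= hp].
by rewrite (le_trans hp) // lerDl.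
Qed.

Lemma rc_term_fil p n s : (rc_gen_pred s -> (size s)%:Z = n + 1) ->
  (tuple_length s)%:Z <= p -> rc_term s \in rc_fil p n.
Proof.
move=> hs hp; rewrite /rc_term; case: insubP => [g gs gE|_]; last exact: rpred0.
apply/allP=> k /(fsubsetP msuppU_le); rewrite inE => /eqP ->.
by rewrite -[rc_tuple g]/(val g) gE hp hs //= eqxx.
Qed.

Lemma rc_bd_fil p n x : x \in rc_fil p n -> rc_bd x \in rc_fil p (n - 1).
Proof.
move/allP=> h; rewrite (freemod_sumE x) linear_sum big_seq.
apply: rpred_sum => g /h /andP[/eqP gn gp]; rewrite linearZ rpredZ //.
rewrite [rc_bd _]rc_bd_genE.
apply: rpred_sum => i _; apply: rpredZ; apply: rc_term_fil => [_|].
  rewrite size_face // subrK; apply: (addIr 1); rewrite -gn -PoszD addn1.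
  by rewrite prednK //; case: i => i; apply: leq_trans.
apply: le_trans gp; rewrite lez_nat tuple_length_face //.
exact: rc_gen_reach.
Qed.

Definition reachability_complex : filtered_complex R :=
  FilteredComplex rc_fil_le rc_bd_fil rc_bd_bd.
End Complex.
End ReachabilityComplex.

Section ReachabilityMap.
Variables (R : comPzRingType) (G H : digraph) (f : digraph_map G H).
Local Notation RC K := (freemod R (rc_gen K)).

Lemma reach_dist_map (x y : G) : reach x y ->
  reach (f x) (f y) /\ (dist (f x) (f y) <= dist x y)%N.
Proof.
suff wP n : walk x y n -> exists2 m, (m <= n)%N & walk (f x) (f y) m.
  move=> /reach_walk /wP[m mn /walk_reach[-> h]]; split=> //.
  exact: leq_trans mn.
move=> /asboolP[p [+ <- <-]]; elim: p x => [|z p IH] x /=.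
  by exists 0; rewrite ?walk0.
case/andP=> /(dmapP f) fxz /IH[m mp w].
case: fxz => [->|e]; first by exists m; rewrite // leqW.
exists m.+1 => //; rewrite -add1n; apply: walk_cat w.
by apply/asboolP; exists [:: f z]; rewrite /= e.
Qed.

Lemma reach_map s : sorted (@reach G) s -> sorted (@reach H) (map f s).
Proof. by apply: homo_sorted => x y /reach_dist_map[]. Qed.

Lemma tuple_length_map s : sorted (@reach G) s ->
  (tuple_length (map f s) <= tuple_length s)%N.
Proof.
case: s => //= x s; elim: s x => //= y s IH x /andP[xy /IH].
by apply: leq_add; case: (reach_dist_map xy).
Qed.

(* A tuple whose image has a repetition of consecutive entries is sent to 0. *)
Definition rc_map_gen (g : rc_gen G) : RC H := rc_term R (map f g).

Definition rc_map : {linear RC G -> RC H} := freemod_lift rc_map_gen.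

Lemma rc_map_genE g : rc_map (freemod_gen R g) = rc_map_gen g.
Proof. exact: freemod_lift_gen. Qed.

Lemma rc_map_term s : sorted (@reach G) s ->
  rc_map (rc_term R s) = rc_term R (map f s).
Proof.
have [gs _|ngs rs] := boolP (rc_gen_pred s).
  by rewrite -[s]/(rc_tuple (RCGen gs)) rc_term_gen rc_map_genE.
rewrite rc_term_nongen // linear0.
case: s ngs rs => [|y s] ngs rs; first by rewrite /= rc_term_nongen.
have [s1 [x [s2 ->]]] := @nongenP _ (y :: s) isT rs ngs.
by rewrite map_cat /= rc_term_rep.
Qed.

Lemma rc_map_d x : rc_bd R H (rc_map x) = rc_map (rc_bd R G x).
Proof.
apply: (@freemod_lin_ext _ _ _ (rc_bd R H \o rc_map) (rc_map \o rc_bd R G)).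
move=> g /=; rewrite [rc_map _]rc_map_genE [rc_bd _ _ (freemod_gen _ _)]rc_bd_genE.
have rg := rc_gen_reach g.
rewrite rc_bd_term ?reach_map // linear_sum size_map; apply: eq_bigr => i _.
rewrite linearZ [rc_map _]rc_map_term ?face_reach //.
by rewrite /face map_cat map_take map_drop.
Qed.

Lemma rc_map_fil p n x : x \in rc_fil R G p n -> rc_map x \in rc_fil R H p n.
Proof.
move/allP=> h; rewrite (freemod_sumE x) linear_sum big_seq.
apply: rpred_sum => g /h /andP[/eqP gn gp]; rewrite linearZ rpredZ //.
rewrite [rc_map _]rc_map_genE; apply: rc_term_fil => [_|].
  by rewrite size_map.
by apply: le_trans gp; rewrite lez_nat tuple_length_map // rc_gen_reach.
Qed.

Definition reachability_map :
    filtered_map (reachability_complex R G) (reachability_complex R H) :=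
  @FilteredMap _ (reachability_complex R G) (reachability_complex R H)
    rc_map rc_map_d rc_map_fil.
End ReachabilityMap.

Definition mpss (R : comPzRingType) (G : digraph) (r : nat) (i j : int) :
    lmodType R :=
  ss_page (reachability_complex R G) r i j.

Definition PH (R : comPzRingType) (G : digraph) (k l : int) : lmodType R :=
  mpss R G 2 l (k - l).

Definition PH_map (R : comPzRingType) (G H : digraph) (f : digraph_map G H)
    (k l : int) : {linear PH R G k l -> PH R H k l} :=
  ss_page_map (reachability_map R f) 2 l (k - l).

Section BidirectedCycle.

Definition two_intervals (m n : nat) := ('I_m.+1 + 'I_n.+1)%type.

Definition interval_edge m n : rel (two_intervals m n) := fun u v =>
  match u, v with
  | inl i, inl j => j == i.+1 :> nat
  | inr i, inr j => j == i.+1 :> nat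
  | _, _ => false
  end.

(* Replaces the two ends of the second interval by those of the first one;
   see [gluedE] for the relation that this defines. *)
Definition end_repr m n (u : two_intervals m n) : two_intervals m n :=
  match u with
  | inl i => inl i
  | inr j => if j == ord0 then inl ord0
             else if j == ord_max then inl ord_max else inr j
  end.

Definition glued m n : rel (two_intervals m n) :=
  fun u v => end_repr u == end_repr v.

Lemma glued_equiv m n : equiv_class_of (@glued m n).
Proof.
split=> [u|u v|v u w]; rewrite /glued ?eqxx // 1?eq_sym //.
by rewrite eq_sym => /eqP->.
Qed.
Lemma gluedE m n (u v : two_intervals m n) : (0 < m)%N -> (0 < n)%N ->
  let is_start w := (w == inl ord0) || (w == inr ord0) in
  let is_end w := (w == inl ord_max) || (w == inr ord_max) in
  glued u v = [|| u == v, is_start u && is_start v | is_end u && is_end v].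
Proof.
case: m u v => // m u v _; case: n u v => // n u v _ /=.
have il (i j : 'I_m.+2) : (inl i == inl j :> two_intervals m.+1 n.+1) = (i == j).
  by [].
have ir (i j : 'I_n.+2) : (inr i == inr j :> two_intervals m.+1 n.+1) = (i == j).
  by [].
have lr (i : 'I_m.+2) (j : 'I_n.+2) :
    (inl i == inr j :> two_intervals m.+1 n.+1) = false by [].
have rl (i : 'I_m.+2) (j : 'I_n.+2) :
    (inr j == inl i :> two_intervals m.+1 n.+1) = false by [].
rewrite /glued; case: u v => [i|i] [j|j] /=; rewrite ?(il, ir, lr, rl) /= ?orbF.
- by case: (i =P j) => //= ij; symmetry; apply/norP; split; apply/andP;
    case=> /eqP a /eqP b; case: ij; rewrite a b.
- case: (j =P ord0) => [->|_]; rewrite ?il /= ?andbT ?andbF ?orbF //.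
  by case: (j =P ord_max) => _; rewrite ?il ?lr /= ?andbT ?andbF ?orbF.
- case: (i =P ord0) => [->|_]; rewrite ?il /= ?andbT ?andbF ?orbF 1?eq_sym //.
  by case: (i =P ord_max) => _; rewrite ?il ?rl /= ?andbT ?andbF ?orbF 1?eq_sym.
have [->|i0] := eqVneq i ord0; have [->|j0] := eqVneq j ord0 => //=.
- by case: (j =P ord_max) => _ //=; rewrite eq_sym (negbTE j0).
- by rewrite (negbTE i0); case: (i =P ord_max) => _.
have [E|im] := eqVneq i ord_max; have [E'|jm] := eqVneq j ord_max => //=.
- by rewrite orbT eqxx.
- by rewrite orbF E eq_sym [RHS]eq_sym (negbTE jm).
- by rewrite orbF E' (negbTE im).
by rewrite ir !orbF.
Qed.
Canonical glued_equivRel m n := EquivRelPack (glued_equiv m n).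

Definition cycle_vertex m n := {eq_quot (@glued m n)}.
HB.instance Definition _ m n := Choice.on (cycle_vertex m n).
HB.instance Definition _ m n := EqQuotient.on (cycle_vertex m n).

Definition cycle_edge m n : rel (cycle_vertex m n) := fun x y =>
  [exists u, exists v,
    [&& \pi_(cycle_vertex m n) u == x, \pi_(cycle_vertex m n) v == y
      & interval_edge u v]].

Definition bicycle (m n : nat) : digraph := Digraph (@cycle_edge m n).

(* [contract_snd] contracts all edges of the second interval except the last;
   [contract_fst] does the same for the first interval, the second one becoming
   the first interval of the target. *)
Definition contract_snd_pre m n (u : two_intervals m n) : two_intervals m 1 :=
  match u with
  | inl i => inl i
  | inr j => inr (if (j < n)%N then ord0 else ord_max)
  end.

Definition contract_fst_pre m n (u : two_intervals m n) : two_intervals n 1 :=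
  match u with
  | inl i => inr (if (i < m)%N then ord0 else ord_max)
  | inr j => inl j
  end.

Definition contract_snd_fun m n (x : bicycle m n) : bicycle m 1 :=
  \pi_(cycle_vertex m 1) (contract_snd_pre (repr x)).

Definition contract_fst_fun m n (x : bicycle m n) : bicycle n 1 :=
  \pi_(cycle_vertex n 1) (contract_fst_pre (repr x)).

Lemma pi_end_repr m n (u : two_intervals m n) :
  \pi_(cycle_vertex m n) (end_repr u) = \pi_(cycle_vertex m n) u.
Proof.
apply/eqmodP; rewrite /= /glued; case: u => //= j.
case: (j =P ord0) => [//|/eqP j0]; case: (j =P ord_max) => [//|/eqP jn] /=.
by rewrite (negbTE j0) (negbTE jn).
Qed.

Lemma end_repr_pi m n (u : two_intervals m n) :
  end_repr (repr (\pi_(cycle_vertex m n) u)) = end_repr u.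
Proof. by apply/eqP; rewrite -/(glued _ _); apply/eqmodP; rewrite reprK. Qed.

Section ContractSnd.
Variables (m n : nat) (n_gt0 : (0 < n)%N).

Lemma contract_snd_end (u : two_intervals m n) :
  \pi_(cycle_vertex m 1) (contract_snd_pre (end_repr u))
  = \pi_(cycle_vertex m 1) (contract_snd_pre u).
Proof.
case: u => //= j; case: (j =P ord0) => [->|_] /=.
  by rewrite n_gt0 -[RHS]pi_end_repr.
case: (j =P ord_max) => [->|//] /=.
by rewrite ltnn -[RHS]pi_end_repr.
Qed.

Lemma contract_snd_funE (u : two_intervals m n) :
  contract_snd_fun (\pi_(cycle_vertex m n) u)
  = \pi_(cycle_vertex m 1) (contract_snd_pre u).
Proof.
by rewrite /contract_snd_fun -contract_snd_end end_repr_pi contract_snd_end.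
Qed.

Fact contract_snd_subproof (x y : bicycle m n) : edge x y ->
  contract_snd_fun x = contract_snd_fun y \/
  edge (contract_snd_fun x) (contract_snd_fun y).
Proof.
case/existsP=> u /existsP[v /and3P[/eqP <- /eqP <-]].
rewrite !contract_snd_funE.
have E a b : interval_edge a b ->
    @edge (bicycle m 1) (\pi_(cycle_vertex m 1) a) (\pi_(cycle_vertex m 1) b).
  by move=> ab; apply/existsP; exists a; apply/existsP; exists b; rewrite !eqxx.
case: u v => [i|i] [j|j] //= ij; first by right; apply: E.
rewrite (eqP ij) -[(i < n)%N]/(i.+1 <= n)%N -(eqP ij) -ltnS ltn_ord.
by case: ltnP => _; [left | right; apply: E].
Qed.

Definition contract_snd : digraph_map (bicycle m n) (bicycle m 1) :=
  DigraphMap contract_snd_subproof.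
End ContractSnd.

Section ContractFst.
Variables (m n : nat) (m_gt0 : (0 < m)%N).

Lemma contract_fst_end (u : two_intervals m n) :
  \pi_(cycle_vertex n 1) (contract_fst_pre (end_repr u))
  = \pi_(cycle_vertex n 1) (contract_fst_pre u).
Proof.
case: u => //= j; case: (j =P ord0) => [->|_] /=.
  by rewrite m_gt0 -[LHS]pi_end_repr.
case: (j =P ord_max) => [->|//] /=.
by rewrite ltnn -[LHS]pi_end_repr.
Qed.

Lemma contract_fst_funE (u : two_intervals m n) :
  contract_fst_fun (\pi_(cycle_vertex m n) u)
  = \pi_(cycle_vertex n 1) (contract_fst_pre u).
Proof.
by rewrite /contract_fst_fun -contract_fst_end end_repr_pi contract_fst_end.
Qed.

Fact contract_fst_subproof (x y : bicycle m n) : edge x y ->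
  contract_fst_fun x = contract_fst_fun y \/
  edge (contract_fst_fun x) (contract_fst_fun y).
Proof.
case/existsP=> u /existsP[v /and3P[/eqP <- /eqP <-]].
rewrite !contract_fst_funE.
have E a b : interval_edge a b ->
    @edge (bicycle n 1) (\pi_(cycle_vertex n 1) a) (\pi_(cycle_vertex n 1) b).
  by move=> ab; apply/existsP; exists a; apply/existsP; exists b; rewrite !eqxx.
case: u v => [i|i] [j|j] //= ij; last by right; apply: E.
rewrite (eqP ij) -[(i < m)%N]/(i.+1 <= m)%N -(eqP ij) -ltnS ltn_ord.
by case: ltnP => _; [left | right; apply: E].
Qed.

Definition contract_fst : digraph_map (bicycle m n) (bicycle n 1) :=
  DigraphMap contract_fst_subproof.
End ContractFst.
End BidirectedCycle.

(* Main.v *)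
Require Import Defs.
From mathcomp Require Import all_boot all_algebra.
From HB Require Import structures.
From mathcomp Require Import order finmap generic_quotient boolp zify.
From mathcomp.multinomials Require Import monalg.

(** Contract the shorter interval [b] of [G = C_(m,n)], [n <= m], onto the
    chord of [H = C_(m,1)]; the longer interval [a] of [G] is mapped to the
    path [c] of [H]. Both graphs are acyclic and a tuple never leaves one
    interval, so reachability chains are increasing sequences of positions.

    Sending [c_i] to [a_i] gives a chain map [lift] from RC(H) to RC(G), which
    is not filtered because (c_0, c_m) has length 1 and (a_0, a_m) has length
    [n]. Let [fill] send (c_0, c_m) to the sum of the triangles
    (b_0, b_l, b_(l+1)), and all other tuples to 0. The homotopic chain map
    [lift + d fill + fill d] sends (c_0, c_m) to the sum of the edges of [b],
    of length 1, and (c_0, c_i, c_m) to itself plus triangles of length at most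
    [n <= m]: it is filtered, and a right inverse of the contraction [f].
    The other composite is homotopic to the identity through the prism operator
      (u, j) |-> (-1)^|u| sum_(last u <= l < j) (u, b_l, b_(l+1))
    on the tuples of [b], which raises the filtration by at most 1. The
    difference of two maps that are homotopic in this sense vanishes on the page
    E^2. *)

Set Implicit Arguments.
Unset Strict Implicit.
Unset Printing Implicit Defensive.

Import Order.TTheory GRing.Theory.

Local Open Scope ring_scope.
Local Open Scope quotient_scope.

(** * Homotopies of filtration degree 1 *)

Section FilteredHomotopy.
Variables (R : pzRingType) (C C' : filtered_complex R).
Variables (f : filtered_map C C') (g : filtered_map C' C).
Variable h : {linear fc_total C -> fc_total C}.
Hypothesis fgK : forall x, fc_map f (fc_map g x) = x.
Hypothesis h_fil : forall p n x,
  x \in fc_fil C p n -> h x \in fc_fil C (p + 1) (n + 1).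
Hypothesis hE : forall x,
  fc_d C (h x) + h (fc_d C x) = x - fc_map g (fc_map f x).

(** By [hE] the difference is [h (d x) + d (h x)]. As [d x] lies in filtration p - 2, [h (d x)] lies
    in p - 1, and [h x] lies in p + 1 = p + r - 1 for r = 2: these are the two filtration degrees
    allowed in a boundary of the page E^2. *)
Lemma homotopy_bound p n x :
  x \in ss_cycle C 2 p n -> x - fc_map g (fc_map f x) \in ss_bound C 2 p n.
Proof.
move=> xZ.
have [xF dxF] : x \in fc_fil C p n /\ fc_d C x \in fc_fil C (p - 2) (n - 1).
  by apply/andP.
rewrite [_ \in ss_bound _ _ _ _]unfold_in /= /ss_bound_mem; apply/asboolP.
have hd : h (fc_d C x) \in fc_fil C (p - 1) n.
  have := h_fil dxF; rewrite subrK.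
  by rewrite (_ : p - 2 + 1 = p - 1) //; lia.
have gfF q k y : y \in fc_fil C q k -> y - fc_map g (fc_map f y) \in fc_fil C q k.
  by move=> yF; rewrite rpredB // !fc_map_fil.
exists (h (fc_d C x)), (h x); split; last by rewrite -hE addrC.
(* Apply the homotopy identity to [d x] itself: the boundary of [h (d x)] is [d x] minus its image,
   hence stays in filtration p - 2. *)
- rewrite [_ \in ss_cycle _ _ _ _]unfold_in /= /ss_cycle_mem hd /=.
  have := hE (fc_d C x); rewrite fc_dd linear0 addr0 => ->.
  by rewrite (_ : p - 1 - (2 - 1) = p - 2) ?gfF //; lia.
rewrite [_ \in ss_cycle _ _ _ _]unfold_in /= /ss_cycle_mem.
rewrite (_ : p + 2 - 1 = p + 1) ?h_fil //=; last by lia.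
rewrite (_ : p + 1 - (2 - 1) = p) ?addrK; last by lia.
have -> : fc_d C (h x) = x - fc_map g (fc_map f x) - h (fc_d C x).
  by rewrite -hE addrK.
rewrite rpredB ?gfF // -[p](subrK 1); exact: fc_fil_le.
Qed.

Lemma homotopy_page2_bij i j : bijective (ss_page_map f 2 i j).
Proof.
exists (ss_page_map g 2 i j) => q; rewrite -(subq_reprK q).
  rewrite /ss_page_map /= !subq_mapE; apply/subq_piE => /=.
  rewrite -opprB -[_ \in _]/(_ \in ss_bound C 2 i (i + j)) rpredN.
  apply: homotopy_bound.
  exact: valP (generic_quotient.repr q).
rewrite /ss_page_map /= !subq_mapE; apply/subq_piE => /=.
by rewrite fgK subrr -[_ \in _]/(_ \in ss_bound C' 2 i (i + j)) rpred0.
Qed.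

End FilteredHomotopy.

Lemma linear_supported (R : pzRingType) (K : choiceType) (M : lmodType R)
    (F : {linear freemod R K -> M}) (P : pred K) (S : submodule M) x :
  (forall k, P k -> F (freemod_gen R k) \in S) ->
  x \in supported R P -> F x \in S.
Proof.
move=> FS /allP xP; rewrite (freemod_sumE x) linear_sum big_seq.
by apply: rpred_sum => k /xP /FS kS; rewrite linearZ rpredZ.
Qed.

(** * Chain maps induced by functions that preserve reachability *)

Section ReachMap.
Variables (R : comPzRingType) (G H : digraph) (f : G -> H).
Hypothesis f_reach : forall x y : G, reach x y -> reach (f x) (f y).
Local Notation RC K := (freemod R (rc_gen K)).

(** Reachability is enough for a chain map, but not for a filtered one. This generality serves
    [lift_vertex], which may send the chord to a pair that is not an edge. *)
Definition tuple_map : {linear RC G -> RC H} :=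
  freemod_lift (fun g : rc_gen G => rc_term R (map f g)).

Lemma tuple_map_term s : sorted (@reach G) s ->
  tuple_map (rc_term R s) = rc_term R (map f s).
Proof.
have [gs _|ngs rs] := boolP (rc_gen_pred s).
  by rewrite -[s]/(rc_tuple (RCGen gs)) rc_term_gen [LHS]freemod_lift_gen.
rewrite rc_term_nongen // linear0.
case: s ngs rs => [|y s] ngs rs; first by rewrite /= rc_term_nongen.
have [s1 [x [s2 ->]]] := @nongenP _ (y :: s) isT rs ngs.
by rewrite map_cat /= rc_term_rep.
Qed.

Lemma tuple_map_bd x : rc_bd R H (tuple_map x) = tuple_map (rc_bd R G x).
Proof.
apply: (@freemod_lin_ext _ _ _ (rc_bd R H \o tuple_map) (tuple_map \o rc_bd R G)).
move=> g /=; have rg := rc_gen_reach g.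
rewrite [tuple_map _]freemod_lift_gen rc_bd_genE.
rewrite rc_bd_term ?(homo_sorted f_reach) // linear_sum size_map.
apply: eq_bigr => i _; rewrite linearZ /= tuple_map_term ?face_reach //.
by rewrite /face map_cat map_take map_drop.
Qed.

End ReachMap.

(** * Reachability and distance on two glued paths *)

Section Reach.
Variable G : digraph.

Lemma reach_invariant (P : G -> Prop) (x y : G) :
  (forall u v, edge u v -> P u -> P v) -> reach x y -> P x -> P y.
Proof.
move=> eP /reach_walk/asboolP[p [+ <- _]]; elim: p x => //= z p IH x.
by case/andP=> /eP xz /IH h /xz.
Qed.

(** A suitable potential bounds a distance from below without any description of the shortest
    walks. *)
Lemma dist_potential (phi : G -> nat) (x y : G) :
  (forall u v, edge u v -> (phi v <= (phi u).+1)%N) -> reach x y ->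
  (phi y <= phi x + dist x y)%N.
Proof.
move=> ephi /reach_walk/asboolP[p [+ <- <-]].
elim: p x => [|z p IH] x /=; first by rewrite addn0.
by case/andP=> /ephi xz /IH; lia.
Qed.

Lemma dist_gt0 (x y : G) : reach x y -> x != y -> (0 < dist x y)%N.
Proof.
rewrite lt0n => /reach_walk w; apply: contra => /eqP d0; move: w; rewrite d0.
by move=> /asboolP[p [_ <- /size0nil ->]].
Qed.

Lemma reach_comparable (s : seq G) x y : sorted (@reach G) s ->
  x \in s -> y \in s -> reach x y \/ reach y x.
Proof.
rewrite (sorted_pairwise (@reach_trans G)) => + xs; case/splitPr: xs => s1 s2.
rewrite pairwise_cat /= allrel_consr => /and4P[/andP[/allP h1 _] _ /allP h2 _].
rewrite mem_cat inE => /or3P[/h1|/eqP->|/h2]; [by right|left|by left].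
exact: reachxx.
Qed.

Lemma path_walk (a : nat -> G) m i j :
  (forall i, (i < m)%N -> edge (a i) (a i.+1)) ->
  (i <= j <= m)%N -> reach (a i) (a j) /\ (dist (a i) (a j) <= j - i)%N.
Proof.
move=> ea; case/andP=> ij jm; apply: walk_reach.
rewrite -{1}(subnKC ij); move: (j - i)%N (subnKC ij) => k ijk.
have {ij ijk jm} : (i + k <= m)%N by rewrite ijk.
elim: k => [|k IH] h; first by rewrite addn0 walk0.
rewrite addnS -[k.+1]addn1; apply: (@walk_cat _ _ (a (i + k))).
  by apply: IH; lia.
by apply/asboolP; exists [:: a (i + k).+1]; rewrite /= ea //; lia.
Qed.

End Reach.

(* [G] is two directed paths [a] and [b] of [m] and [n] edges with common ends;
   only the values [a i], [i <= m], and [b j], [j <= n], matter. *)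
Record two_paths (G : digraph) (m n : nat) (a b : nat -> G) : Prop := TwoPaths {
  tp_cover : forall x, (exists2 i, (i <= m)%N & x = a i) \/
                       (exists2 j, (j <= n)%N & x = b j);
  tp_edge : forall x y, edge x y <->
    ((exists2 i, (i < m)%N & x = a i /\ y = a i.+1) \/
     (exists2 j, (j < n)%N & x = b j /\ y = b j.+1));
  tp_start : a 0 = b 0;
  tp_end : a m = b n;
  tp_injl : forall i i', (i <= m)%N -> (i' <= m)%N -> a i = a i' -> i = i';
  tp_injr : forall j j', (j <= n)%N -> (j' <= n)%N -> b j = b j' -> j = j';
  tp_glue : forall i j, (i <= m)%N -> (j <= n)%N -> a i = b j ->
    (i = 0 /\ j = 0)%N \/ (i = m /\ j = n)
}.

Lemma two_paths_sym G m n a b : @two_paths G m n a b -> two_paths n m b a.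
Proof.
case=> cov ed st en il ir gl; split=> //.
- by move=> x; case: (cov x); [right|left].
- by move=> x y; rewrite ed; split=> -[]; [right|left|right|left].
by move=> j i hj hi e; case: (gl i j hi hj (esym e)) => -[-> ->]; [left|right].
Qed.

Section TwoPaths.
Variables (G : digraph) (m n : nat) (a b : nat -> G).
Hypothesis tp : two_paths m n a b.

(** Off the path [a] the value is [m.+1]. *)
Definition fpos : G -> nat := fun x => index x [seq a i | i <- iota 0 m.+1].
Definition onfst : pred G := fun x => x \in [seq a i | i <- iota 0 m.+1].

Lemma onfstP x : reflect (exists2 i, (i <= m)%N & x = a i) (onfst x).
Proof.
apply: (iffP mapP) => -[i hi ->]; exists i => //; move: hi;
  by rewrite mem_iota.
Qed.

Lemma fposE i : (i <= m)%N -> fpos (a i) = i.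
Proof.
move=> im; rewrite /fpos -[X in index X]/((fun i => a i) i).
have sz : size [seq a i | i <- iota 0 m.+1] = m.+1 by rewrite size_map size_iota.
have ai : nth (a 0) [seq a i | i <- iota 0 m.+1] i = a i.
  by rewrite (nth_map 0%N) ?size_iota // nth_iota.
rewrite -[X in index X _]ai index_uniq ?sz // map_inj_in_uniq ?iota_uniq //.
by move=> j k; rewrite !mem_iota => hj hk; apply: (tp_injl tp).
Qed.

Lemma fposK x : onfst x -> a (fpos x) = x /\ (fpos x <= m)%N.
Proof. by case/onfstP=> i im ->; rewrite fposE. Qed.

Lemma edge_fst i : (i < m)%N -> edge (a i) (a i.+1).
Proof. by move=> im; apply/(tp_edge tp); left; exists i. Qed.

Lemma reach_fst_le i j : (i <= j <= m)%N -> reach (a i) (a j).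
Proof. by case/(path_walk edge_fst). Qed.

Lemma dist_fst_le i j : (i <= j <= m)%N -> (dist (a i) (a j) <= j - i)%N.
Proof. by case/(path_walk edge_fst). Qed.

(** The set of [a j] with i <= j <= m is closed under edges: an edge of [b] starts at some [b k]
    with k < n, and such a vertex lies on [a] only if it is the initial one, which 0 < i
    excludes. *)
Lemma reach_interior i y : (0 < i <= m)%N -> reach (a i) y ->
  exists2 j, (i <= j <= m)%N & y = a j.
Proof.
move=> im /(@reach_invariant _ (fun y => exists2 j, (i <= j <= m)%N & y = a j)).
apply; last by exists i => //; rewrite leqnn; case/andP: im.
move=> u v /(tp_edge tp) [] [k km [-> ->]] [j jm e].
  have kj : k = j by apply: (tp_injl tp) e; lia.
  by exists k.+1 => //; lia.
by case: (@tp_glue _ _ _ _ _ tp j k) => //; try lia; case=> *; lia.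
Qed.

Lemma reach_fst i j : (i <= m)%N -> (j <= m)%N -> reach (a i) (a j) = (i <= j)%N.
Proof.
move=> im jm; apply/idP/idP => [|ij]; last by apply: reach_fst_le; rewrite ij.
case: (posnP i) => [->//|i0] /reach_interior [|k km e]; first by rewrite i0.
by rewrite (tp_injl tp jm _ e); case/andP: km.
Qed.

End TwoPaths.

Section TwoPathsBoth.
Variables (G : digraph) (m n : nat) (a b : nat -> G).
Hypothesis tp : two_paths m n a b.
Let pt := two_paths_sym tp.
Local Notation onA := (onfst m a).
Local Notation onB := (onfst n b).

Lemma onfst_interior i : (0 < i < m)%N -> onB (a i) = false.
Proof.
case/andP=> i0 im; apply/negP => /onfstP [j jn e].
by case: (tp_glue tp (ltnW im) jn e) => -[]; lia.
Qed.

(** A walk from a non-initial vertex stays on its path by [reach_interior], and the initial vertex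
    lies on both paths. *)
Lemma reach_same_path x y : reach x y -> onA x && onA y \/ onB x && onB y.
Proof.
have H (p q : nat) (c d : nat -> G) (tq : two_paths p q c d) u v :
    reach u v -> onfst p c u -> onfst p c u && onfst p c v \/
    onfst q d u && onfst q d v.
  move=> r ou; rewrite ou; case/onfstP: (ou) => i ip e.
  case: (posnP i) => i0; last first.
    left; move: r; rewrite e => /(reach_interior tq) [|j jp ->].
      by rewrite i0.
    by apply/onfstP; exists j => //; case/andP: jp.
  have ud : onfst q d u.
    by apply/onfstP; exists 0%N => //; rewrite e i0 (tp_start tq).
  by rewrite ud; case: (tp_cover tq v) => -[j jp ->]; [left|right];
    apply/onfstP; exists j.
move=> r; case: (tp_cover tp x) => -[j jp e].
  by apply: (H _ _ _ _ tp) => //; apply/onfstP; exists j.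
by apply/or_comm; apply: (H _ _ _ _ pt) => //; apply/onfstP; exists j.
Qed.

(** The common ends are read on [a]; the equations [u 0 = v 0] and [u m = v n] below make this
    choice immaterial. *)
Definition glue_fun (u v : nat -> nat) : G -> nat :=
  fun x => if onA x then u (fpos m a x) else v (fpos n b x).

Lemma glue_funl u v i : (i <= m)%N -> glue_fun u v (a i) = u i.
Proof.
move=> im; rewrite /glue_fun (fposE tp) // ifT //.
by apply/onfstP; exists i.
Qed.

Lemma glue_funr (u v : nat -> nat) j : u 0%N = v 0%N -> u m = v n ->
  (j <= n)%N -> glue_fun u v (b j) = v j.
Proof.
move=> uv0 uv1 jn; rewrite /glue_fun (fposE pt) //.
case: onfstP => // -[i im e]; rewrite e (fposE tp) //.
by case: (tp_glue tp im jn (esym e)) => -[-> ->].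
Qed.

Lemma dist_glue (u v : nat -> nat) x y : u 0%N = v 0%N -> u m = v n ->
  (forall i, (i < m)%N -> (u i.+1 <= (u i).+1)%N) ->
  (forall j, (j < n)%N -> (v j.+1 <= (v j).+1)%N) ->
  reach x y -> (glue_fun u v y <= glue_fun u v x + dist x y)%N.
Proof.
move=> uv0 uv1 hu hv; apply: dist_potential => {}x {}y /(tp_edge tp).
case=> -[k km [-> ->]]; first by rewrite !glue_funl ?hu // ltnW.
by rewrite !glue_funr ?hv // ltnW.
Qed.

(* The potential [min i n] on [a i], [j] on [b j] grows by at most 1 per edge. *)
Lemma dist_snd i j : (n <= m)%N -> (i <= j <= n)%N ->
  dist (b i) (b j) = (j - i)%N.
Proof.
move=> nm ijn; case/andP: (ijn) => ij jn.
have := @dist_glue (fun i => minn i n) id (b i) (b j).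
rewrite !glue_funr //; [|lia..]; move/(_ (min0n _)).
move=> /(_ ltac:(lia) ltac:(lia) ltac:(lia) (reach_fst_le pt ijn)).
by have := dist_fst_le pt ijn; lia.
Qed.

End TwoPathsBoth.

(** The chord can shorten only the way from [a 0] to [a m]. For any other pair some potential agrees
    with the position at both vertices and grows by at most 1 along the chord. *)
Lemma dist_shortcut (G : digraph) (m : nat) (a b : nat -> G) i j :
  two_paths m 1 a b -> (0 < m)%N ->
  (i <= j <= m)%N -> (0 < i)%N || (j < m)%N -> (j - i <= dist (a i) (a j))%N.
Proof.
move=> tp m0 ijm; have r := reach_fst_le tp ijm; case/andP: ijm => ij jm h.
have im := leq_trans ij jm.
case: (posnP i) h => [i0|i0 _] /= => [jm'|].
  (* Since j < m, the value at the final vertex may be lowered to 1, which the chord permits. *)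
  pose u k := if (k < m)%N then k else 1%N.
  have := dist_glue tp (u := u) (v := id) _ _ _ _ r.
  rewrite !(glue_funl tp) // /u i0 jm' m0 ltnn.
  move=> H; rewrite leq_subLR; apply: H => // k km.
  by rewrite km; case: ltnP; lia.
(* Since 0 < i, the value at the initial vertex may be raised to m, which makes the chord level. *)
pose u k := if (0 < k)%N then k else m.
have := dist_glue tp (u := u) (v := fun=> m) _ _ _ _ r.
rewrite !(glue_funl tp) // /u i0 m0 (leq_trans i0 ij) /=.
move=> /(_ erefl erefl) H; rewrite leq_subLR; apply: H => // k km.
by case: (posnP k) => [->|_].
Qed.

(** * The prism operator *)

Lemma rc_bd_cat (R : comPzRingType) (G : digraph) (s t : seq G) :
  sorted (@reach G) (s ++ t) ->
  rc_bd R G (rc_term R (s ++ t)) =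
    \sum_(i < size s) (-1) ^+ i *: rc_term R (face i s ++ t) +
    (-1) ^+ size s *: \sum_(i < size t) (-1) ^+ i *: rc_term R (s ++ face i t).
Proof.
move=> st; rewrite rc_bd_term // size_cat big_split_ord /=; congr (_ + _).
  by apply: eq_bigr => i _; rewrite face_catl.
rewrite scaler_sumr; apply: eq_bigr => i _.
by rewrite face_catr scalerA exprD.
Qed.

Lemma map_face (T : Type) (G : digraph) (b : T -> G) i s :
  face i (map b s) = map b (take i s ++ drop i.+1 s).
Proof. by rewrite /face map_cat map_take map_drop. Qed.

Lemma subseq_remove (T : eqType) e (s : seq T) :
  subseq (take e s ++ drop e.+1 s) s.
Proof.
rewrite -{3}(cat_take_drop e s) cat_subseq //.
by rewrite -addn1 addnC -drop_drop drop_subseq.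
Qed.

(** The inequalities are weak: [rc_term] sends a tuple with a consecutive repetition to 0, so
    degenerate tuples may remain in the formulas. *)
Definition chain n (s : seq nat) : bool :=
  sorted leq s && all (fun i => i <= n)%N s.

Lemma chain_subseq n s t : subseq s t -> chain n t -> chain n s.
Proof.
move=> st /andP[h1 h2]; rewrite /chain (subseq_sorted leq_trans st h1) /=.
by apply/allP => x /(mem_subseq st); apply: (allP h2).
Qed.

Lemma chain_insert n u i l j : chain n (u ++ [:: i; j]) -> (i <= l < j)%N ->
  chain n (u ++ [:: i; l; l.+1]).
Proof.
rewrite /chain !all_cat /= => /andP[h1 /and4P[-> ui uj _]] /andP[il lj].
rewrite ui (leq_trans lj uj) (leq_trans (ltnW lj) uj) !andbT.
case: u h1 {ui} => [|x u] /=; rewrite ?cat_path /= il leqnSn // !andbT.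
by case/and3P=> -> ->.
Qed.

Section Chains.
Variables (G : digraph) (m n : nat) (a b : nat -> G).
Hypothesis tp : two_paths m n a b.

Lemma reach_chain (s : seq G) : sorted (@reach G) s -> all (onfst m a) s ->
  exists2 t, chain m t & s = map a t.
Proof.
move=> rs sa; exists (map (fpos m a) s); last first.
  by rewrite -map_comp map_id_in // => x /(allP sa) /(fposK tp)[].
apply/andP; split; last first.
  by rewrite all_map; apply: sub_all sa => x /(fposK tp)[].
apply: homo_sorted_in sa rs => x y /(fposK tp)[ex xm] /(fposK tp)[ey ym].
by rewrite -{1}ex -{1}ey (reach_fst tp).
Qed.

Lemma chain_strict t : chain m t -> rc_gen_pred (map a t) -> sorted ltn t.
Proof.
case/andP=> t1 t2 /andP[_]; rewrite sorted_map.
apply: (sub_in_sorted _ t2) => i j im jm /=.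
rewrite (reach_fst tp) // ltn_neqAle => /andP[ij ->]; rewrite andbT.
by apply: contra ij => /eqP ->.
Qed.

(** Any two entries are comparable, hence on a common path; comparing each entry with one outside
    [b] puts it on [a]. *)
Lemma all_onfst s : sorted (@reach G) s -> ~~ all (onfst n b) s ->
  all (onfst m a) s.
Proof.
move=> rs /allPn[x xs /negbTE xb]; apply/allP => y ys.
case: (reach_comparable rs xs ys) => /(reach_same_path tp) [] /andP[] //;
  by rewrite xb.
Qed.

End Chains.

Section Prism.
Variables (R : comPzRingType) (G : digraph) (m n : nat) (a b : nat -> G).
Hypothesis tp : two_paths m n a b.
Let pt := two_paths_sym tp.
Local Notation RC := (freemod R (rc_gen G)).
Local Notation d := (rc_bd R G).
Local Notation tb s := (rc_term R (map b s)).

Lemma chain_reach s : chain n s -> sorted (@reach G) (map b s).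
Proof.
case/andP=> h1 h2; apply: (homo_sorted_in _ h2 h1) => i j _ jn ij.
by apply: (reach_fst_le pt); rewrite ij.
Qed.

(** The join of [u] with the path from [b i] to [b j], seen as a 1-chain. *)
Definition edge_sum (u : seq nat) (i j : nat) : RC :=
  \sum_(i <= l < j) tb (u ++ [:: l; l.+1]).

Lemma edge_sumB u k i j : (k <= i <= j)%N ->
  edge_sum u k j - edge_sum u k i = edge_sum u i j.
Proof.
case/andP=> ki ij; rewrite /edge_sum (big_cat_nat ki ij) /=.
by rewrite addrAC subrr add0r.
Qed.

(** Consider the faces of (u, i, l, l+1). Those that omit an entry of u form the first sum, the one
    that omits i gives [edge_sum u i j], and the last two telescope over l to -(u, i, j), because
    (u, i, i) is degenerate. *)
Lemma bd_edge_sum u i j : chain n (u ++ [:: i; j]) -> (i <= j)%N ->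
  d (edge_sum (rcons u i) i j) =
    \sum_(e < size u) (-1) ^+ e *:
       edge_sum (rcons (take e u ++ drop e.+1 u) i) i j +
    (-1) ^+ size u *: (edge_sum u i j - tb (u ++ [:: i; j])).
Proof.
move=> uij ij; rewrite /edge_sum linear_sum /=.
under [X in _ = X + _]eq_bigr do rewrite scaler_sumr.
rewrite exchange_big /=.
have -> : tb (u ++ [:: i; j]) =
    \sum_(i <= l < j) (tb (u ++ [:: i; l.+1]) - tb (u ++ [:: i; l])).
  rewrite (telescope_sumr (fun l => tb (u ++ [:: i; l])) ij).
  by rewrite [X in _ - X](_ : _ = 0) ?subr0 // map_cat /= rc_term_rep.
rewrite -sumrB scaler_sumr -big_split /=; apply: eq_big_nat => l lij.
have := chain_reach (chain_insert uij lij).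
rewrite -cats1 -catA /= map_cat => /rc_bd_cat ->; rewrite size_map.
congr (_ + _).
  by apply: eq_bigr => e _; rewrite map_face -cats1 -catA -map_cat.
congr (_ *: _); rewrite /= !big_ord_recl big_ord0 /= /bump /= !add1n.
rewrite /face /= expr0 expr1 sqrrN expr1n !scale1r scaleN1r addr0.
by rewrite !map_cat /= opprB addrA addrAC addrA.
Qed.

(* For [u = [::]] the sum starts at the initial vertex, and then it is the path
   from there to [b j]; the final vertex [b n] is fixed by the contraction, so
   its image has to be 0 instead. *)
Definition homotopy_gen (g : rc_gen G) : RC :=
  if all (onfst n b) g && (rc_tuple g != [:: b n]) then
    let s := map (fpos n b) g in
    let u := take (size s).-1 s in
    (-1) ^+ size u *: edge_sum u (last 0 u)%N (last 0 s)%N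
  else 0.

Definition homotopy : {linear RC -> RC} := freemod_lift homotopy_gen.

Lemma homotopy_off s : ~~ all (onfst n b) s -> homotopy (rc_term R s) = 0.
Proof.
move=> sB; rewrite /rc_term; case: insubP => [g _ gs|_]; last exact: linear0.
by rewrite [LHS]freemod_lift_gen /homotopy_gen [rc_tuple g]gs (negbTE sB).
Qed.

Lemma chain_on s : chain n s -> all (onfst n b) (map b s).
Proof.
case/andP=> _ h; rewrite all_map; apply: sub_all h => i im /=.
by apply/onfstP; exists i.
Qed.

Lemma chain_fpos s : chain n s -> map (fpos n b) (map b s) = s.
Proof.
case/andP=> _ /allP h; rewrite -map_comp map_id_in // => i /h im /=.
exact: (fposE pt).
Qed.

Lemma homotopy_end : homotopy (tb [:: n]) = 0.
Proof.
rewrite /rc_term; case: insubP => [g _ gs|_]; last exact: linear0.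
by rewrite [LHS]freemod_lift_gen /homotopy_gen [rc_tuple g]gs /= eqxx andbF.
Qed.

(** For a degenerate tuple the left side is 0, and the work is to see that the right side vanishes
    too. *)
Lemma homotopyE u j : chain n (rcons u j) -> (u != [::]) || (j != n) ->
  homotopy (tb (rcons u j)) = (-1) ^+ size u *: edge_sum u (last 0 u)%N j.
Proof.
move=> uj ujn; have rs := chain_reach uj.
have [gs|ngs] := boolP (rc_gen_pred (map b (rcons u j))).
  rewrite -[map b _]/(rc_tuple (RCGen gs)) rc_term_gen [LHS]freemod_lift_gen.
  rewrite /homotopy_gen /= chain_on //= ifT; last first.
    apply/eqP => /(congr1 (map (fpos n b))); move: ujn.
    rewrite chain_fpos //= (fposE pt) //; case: (u) => [|x [|y v]] //=.
    by move=> /eqP jn [].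
  by rewrite chain_fpos // size_rcons -cats1 take_size_cat // last_cat.
rewrite rc_term_nongen // linear0.
have [|s1 [x [s2 e]]] := nongenP _ rs ngs; first by case: (u).
(* If the repetition is at the end, then u ends in j and the sum is empty; otherwise it lies within
   u and persists in every summand. *)
case: (lastP s2) e => [|{}s2 y].
  rewrite -cat1s catA cats1 map_rcons => /rcons_inj [].
  case: (lastP u) uj => [|v k]; first by case: (s1).
  rewrite map_rcons cats1 => uj /rcons_inj [_ <- e].
  rewrite /edge_sum last_rcons.
  have kj : k = j.
    apply: (tp_injr tp _ _ (esym e)); move: uj; rewrite /chain !all_rcons;
      by case/and3P=> _ ? /andP[].
  by rewrite kj big_geq // scaler0.
rewrite -!rcons_cons -rcons_cat map_rcons => /rcons_inj [e _].
rewrite /edge_sum big1 ?scaler0 // => l _.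
by rewrite map_cat e -catA /= rc_term_rep.
Qed.

(** The faces that omit an entry of u cancel between the two composites, because of the sign in
    [homotopy]. The faces (u, j) and (u, i) contribute a difference of two sums, which is
    [edge_sum u i j] and cancels the same term of [bd_edge_sum]. The correction appears when (u, j)
    is the final vertex, on which [homotopy] is 0 instead of the whole path. *)
Lemma homotopy_path u i j : chain n (u ++ [:: i; j]) -> (i < j)%N ->
  d (homotopy (tb (u ++ [:: i; j]))) + homotopy (d (tb (u ++ [:: i; j]))) =
  tb (u ++ [:: i; j]) -
    (if (u == [::]) && (j == n) then edge_sum [::] 0 n else 0).
Proof.
move=> uij ij; have rs := chain_reach uij.
have iE s : s ++ [:: i; j] = rcons (rcons s i) j by rewrite -!cats1 -catA.
have cj : chain n (rcons u j).
  apply: chain_subseq uij; rewrite -cats1 cat_subseq //=.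
  by rewrite ifN ?eqxx // gtn_eqF.
have ci : chain n (rcons u i).
  by apply: chain_subseq uij; rewrite -cats1 cat_subseq //= eqxx.
have jn : (j <= n)%N by move: cj; rewrite /chain all_rcons => /and3P[].
have ui : (last 0 u <= i)%N.
  by move: ci; case: (u) => //= x v; rewrite /chain /= rcons_path; case/andP=> /andP[].
pose T := \sum_(e < size u) (-1) ^+ e *:
  edge_sum (rcons (take e u ++ drop e.+1 u) i) i j.
have signK (x : RC) : (-1) ^+ size u *: ((-1) ^+ size u *: x) = x.
  by rewrite scalerA -exprD addnn -signr_odd odd_double expr0 scale1r.
have -> : d (homotopy (tb (u ++ [:: i; j]))) =
    - ((-1) ^+ size u *: T) - (edge_sum u i j - tb (u ++ [:: i; j])).
  rewrite {1}iE homotopyE -?iE //; last by case: (u).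
  rewrite last_rcons size_rcons [LHS]linearZ /=.
  rewrite bd_edge_sum ?(ltnW ij) // -/T exprS mulN1r scaleNr scalerDr signK.
  by rewrite opprD.
have -> : homotopy (d (tb (u ++ [:: i; j]))) = (-1) ^+ size u *: T +
   (edge_sum u i j - (if (u == [::]) && (j == n) then edge_sum [::] 0 n else 0)).
  rewrite map_cat rc_bd_cat -?map_cat // size_map [LHS]linearD.
  congr (_ + _).
    rewrite linear_sum scaler_sumr; apply: eq_bigr => e _ /=.
    rewrite [LHS]linearZ map_face -(map_cat b _ [:: i; j]) iE -/homotopy.
    rewrite homotopyE ?last_rcons; last by case: (take e u ++ drop e.+1 u).
      rewrite size_rcons size_cat size_drop size_takel ?(ltnW (ltn_ord e)) //.
      rewrite -addnS subnSK ?ltn_ord // subnKC ?(ltnW (ltn_ord e)) //.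
      by rewrite /= !scalerA mulrC.
    by rewrite -iE; apply: chain_subseq uij; rewrite cat_subseq ?subseq_remove.
  rewrite !big_ord_recl big_ord0 /= /bump /= add1n addr0.
  rewrite /face /= expr0 expr1 scale1r scaleN1r.
  rewrite -(map_cat b u [:: j]) -(map_cat b u [:: i]) !cats1.
  rewrite [LHS]linearZ -/homotopy [homotopy _]linearB.
  rewrite (homotopyE ci); last by apply/orP; right; lia.
  have -> : homotopy (tb (rcons u j)) = (-1) ^+ size u *: edge_sum u (last 0 u)%N j
      - (if (u == [::]) && (j == n) then edge_sum [::] 0 n else 0).
    case: ifPn => [/andP[/eqP -> /eqP ->]|]; last first.
      by rewrite negb_and subr0 => /(homotopyE cj).
    by rewrite homotopy_end expr0 scale1r subrr.
  rewrite /= addrAC -scalerBr edge_sumB ?ui ?(ltnW ij) // scalerBr signK.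
  by congr (_ - _); case: (u) => [|? ?] /=; rewrite ?scaler0 // expr0 scale1r.
by rewrite opprB addrACA addNr add0r addrA subrK.
Qed.
End Prism.

(** * The contraction and its right inverse *)

Lemma rc_term_filP (R : comPzRingType) (G : digraph) (s : seq G)
    (k l : nat) (p n : int) :
  size s = k.+1 -> (tuple_length s <= l)%N -> k%:Z = n -> l%:Z <= p ->
  rc_term R s \in rc_fil R G p n.
Proof.
move=> sk sl <- lp; apply: rc_term_fil; first by rewrite sk -addn1 PoszD.
by apply: le_trans lp; rewrite lez_nat.
Qed.

Lemma tuple_length_cons2 (G : digraph) (x y : G) s :
  tuple_length [:: x, y & s] = (dist x y + tuple_length (y :: s))%N.
Proof. by []. Qed.

Lemma tuple_length_cat (G : digraph) (s : seq G) x t :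
  tuple_length (s ++ x :: t) =
    (tuple_length (rcons s x) + tuple_length (x :: t))%N.
Proof.
case: s => [|y s] //; elim: s y => [|z s IH] y; first by rewrite /= addn0.
by rewrite 2!cat_cons rcons_cons tuple_length_cons2 -cat_cons IH addnA.
Qed.

Section Contraction.
Variables (R : comPzRingType) (G H : digraph) (m n : nat).
Variables (a b : nat -> G) (c e : nat -> H) (f : digraph_map G H).
Hypothesis tp : two_paths m n a b.
Hypothesis tq : two_paths m 1 c e.
Hypotheses (n_gt0 : (0 < n)%N) (nm : (n <= m)%N).
Hypothesis f_fst : forall i, (i <= m)%N -> f (a i) = c i.
Hypothesis f_snd : forall j, (j < n)%N -> f (b j) = c 0%N.
Let pt := two_paths_sym tp.
Let m_gt0 : (0 < m)%N := leq_trans n_gt0 nm.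
Local Notation RC K := (freemod R (rc_gen K)).
Local Notation h := (@homotopy R G n b).
Local Notation tb s := (rc_term R (map b s)).
Local Notation ta s := (rc_term R (map a s)).
Local Notation tc s := (rc_term R (map c s)).
Local Notation fx := (rc_map R f).

(** The chord has no interior vertex. Hence all generators of the target are chains on [c]. *)
Lemma target_cover x : exists2 i, (i <= m)%N & x = c i.
Proof.
case: (tp_cover tq x) => // -[[|[|//]] _ ->].
  by exists 0%N; rewrite ?(tp_start tq).
by exists m; rewrite ?(tp_end tq).
Qed.

Lemma target_posK x : c (fpos m c x) = x /\ (fpos m c x <= m)%N.
Proof. by apply: (fposK tq); apply/onfstP/target_cover. Qed.

Lemma reach_target x y : reach x y = (fpos m c x <= fpos m c y)%N.
Proof.
have [ex xm] := target_posK x; have [ey ym] := target_posK y.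
by rewrite -(reach_fst tq) // ex ey.
Qed.

Lemma gen_chain (g : rc_gen H) :
  exists2 t, chain m t /\ sorted ltn t & rc_tuple g = map c t.
Proof.
have [|t mt gt] := reach_chain tq (rc_gen_reach g).
  by apply/allP => x _; apply/onfstP/target_cover.
by exists t => //; split=> //; apply: (chain_strict tq) mt _; rewrite -gt; case: (g).
Qed.

Definition lift_vertex (x : H) : G := a (fpos m c x).

Lemma lift_reach x y : reach x y -> reach (lift_vertex x) (lift_vertex y).
Proof.
have [_ ym] := target_posK y; rewrite reach_target => xy.
by apply: (reach_fst_le tp); rewrite xy.
Qed.

Local Notation lift := (tuple_map R lift_vertex).

Lemma lift_tc s : chain m s -> lift (tc s) = ta s.
Proof.
move=> ms; rewrite tuple_map_term; last exact: (chain_reach (two_paths_sym tq)).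
rewrite -map_comp; congr rc_term; apply/eq_in_map => i /= im.
by rewrite /lift_vertex (fposE tq) //; case/andP: ms => _ /allP /(_ i im).
Qed.

Definition filling : RC G := edge_sum R b [:: 0%N] 0 n.

Definition filling_gen (g : rc_gen H) : RC G :=
  if rc_tuple g == [:: c 0%N; c m] then filling else 0.

Definition fill : {linear RC H -> RC G} := freemod_lift filling_gen.

Lemma fill_term s : sorted (@reach H) s ->
  fill (rc_term R s) = if s == [:: c 0%N; c m] then filling else 0.
Proof.
move=> rs; have [gs|ngs] := boolP (rc_gen_pred s).
  by rewrite -[s in LHS]/(rc_tuple (RCGen gs)) rc_term_gen [LHS]freemod_lift_gen.
rewrite rc_term_nongen // linear0; case: eqP => // se; case/negP: ngs.
rewrite se /rc_gen_pred /= (reach_fst_le tq) // ?andbT; last by rewrite leqnn.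
apply/eqP => /(tp_injl tq); lia.
Qed.

Lemma fill_tc s : chain m s ->
  fill (tc s) = if s == [:: 0%N; m] then filling else 0.
Proof.
move=> ms; rewrite fill_term; last exact: (chain_reach (two_paths_sym tq)).
congr (if _ then _ else _); apply/eqP/eqP => [|->//].
move/(congr1 (map (fpos m c))); rewrite (chain_fpos (two_paths_sym tq)) //= => ->.
by rewrite !(fposE tq).
Qed.

Definition section_map : {linear RC H -> RC G} :=
  (lift \+ (rc_bd R G \o fill)) \+ (fill \o rc_bd R H).

Lemma section_mapE x :
  section_map x = lift x + rc_bd R G (fill x) + fill (rc_bd R H x).
Proof. by []. Qed.

Lemma section_map_bd x : rc_bd R G (section_map x) = section_map (rc_bd R H x).
Proof.
rewrite !section_mapE !linearD /= !rc_bd_bd linear0 !addr0.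
by rewrite tuple_map_bd //; exact: lift_reach.
Qed.

Lemma bd_filling : rc_bd R G filling = edge_sum R b [::] 0 n - ta [:: 0; m].
Proof.
rewrite /filling -[[:: 0%N]]/(rcons [::] 0%N) (bd_edge_sum R tp) //=; last first.
  by rewrite /chain /= leqnn.
by rewrite big_ord0 add0r scale1r (tp_start tp) (tp_end tp).
Qed.

Lemma map_f_chain s : chain m s -> fx (ta s) = tc s.
Proof.
move=> ms; rewrite rc_map_term; last exact: (chain_reach pt).
rewrite -map_comp; congr rc_term; apply/eq_in_map => i im /=.
by apply: f_fst; case/andP: ms => _ /allP /(_ i im).
Qed.

(** For l < n both [b 0] and [b l] go to [c 0], so each triangle becomes degenerate. *)
Lemma map_f_filling : fx filling = 0.
Proof.
rewrite linear_sum big_nat big1 // => l /andP[_ ln].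
rewrite rc_map_term; last first.
  apply: (chain_reach tp); rewrite /chain /= leqnSn ln (ltnW ln) //.
by rewrite map_cat /= (f_snd ln) (f_snd n_gt0); exact: (rc_term_rep R [::]).
Qed.

Lemma map_f_fill x : fx (fill x) = 0.
Proof.
apply: (@freemod_lin_ext _ _ _ (fx \o fill) \0) => g /=.
by rewrite [fill _]freemod_lift_gen /filling_gen; case: ifP; 
  rewrite ?map_f_filling ?linear0.
Qed.

Lemma section_mapK x : fx (section_map x) = x.
Proof.
rewrite section_mapE !linearD /= map_f_fill addr0 -rc_map_d map_f_fill linear0 addr0.
apply: (@freemod_lin_ext _ _ _ (fx \o lift) idfun) => g /=.
have [s [ms _] gs] := gen_chain g.
by rewrite -rc_term_gen gs lift_tc // map_f_chain.
Qed.

(** * The homotopy identity *)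

Lemma chain_ends t : sorted ltn t -> all (fun i => (i == 0) || (i == m))%N t ->
  [\/ t = [::], t = [:: 0%N], t = [:: m] | t = [:: 0%N; m]].
Proof.
case: t => [|x [|y [|z t]]] /=; first by constructor 1.
- by move=> _; rewrite andbT => /orP[] /eqP ->; [constructor 2|constructor 3].
- rewrite !andbT => xy /andP[hx hy]; constructor 4.
  by have [-> ->] : x = 0%N /\ y = m by lia.
by case/and3P=> xy yz _ /and4P[hx hy hz _]; lia.
Qed.

(** A tuple of [a] that also lies on [b] consists of common ends. On the initial vertex the prism is
    an empty sum, on the final vertex it is 0 by definition, and on the pair of both it is the
    filling with the sign of |u| = 1. *)
Lemma homotopy_ta t : chain m t -> sorted ltn t -> h (ta t) = - fill (tc t).
Proof.
move=> mt st; rewrite fill_tc //.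
have [tB|tB] := boolP (all (onfst n b) (map a t)); last first.
  rewrite homotopy_off // ifN ?oppr0 //; apply: contra tB => /eqP ->.
  rewrite /= (tp_start tp) (tp_end tp) andbT.
  by apply/andP; split; apply/onfstP; [exists 0%N | exists n].
have nn : chain n [:: n] by rewrite /chain /= leqnn.
case: (@chain_ends t st) => [|->|->|->|->] /=.
- move: tB; rewrite all_map; case/andP: mt => _ mt tB; apply/allP => i it.
  have := allP mt i it; have := allP tB i it; rewrite /= => + im.
  apply: contraLR; rewrite negb_or -lt0n => /andP[i0 i1].
  by rewrite (onfst_interior tp) // i0 ltn_neqAle i1.
- by rewrite rc_term_nongen // linear0 oppr0.
- rewrite (tp_start tp) -[[:: b 0]]/(map b (rcons [::] 0%N)) (homotopyE R tp) //=.
    by rewrite /edge_sum big_geq // scaler0 ?eqseq_cons ?andbF oppr0.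
  by rewrite eq_sym -lt0n.
- rewrite (tp_end tp) -[[:: b n]]/(map b [:: n]) homotopy_end.
  by rewrite ?eqseq_cons ?andbF oppr0.
rewrite eqxx (tp_start tp) (tp_end tp) -[[:: b 0; b n]]/(map b (rcons [:: 0%N] n)).
by rewrite (homotopyE R tp) //= ?expr1 ?scaleN1r // /chain /= leqnn.
Qed.

Lemma homotopy_lift x : h (lift x) = - fill x.
Proof.
apply: (@freemod_lin_ext _ _ _ (h \o lift) (\- fill)) => g /=.
have [t [mt st] gt] := gen_chain g.
by rewrite -rc_term_gen gt lift_tc // homotopy_ta.
Qed.

Lemma bd_vertex (K : digraph) (x : K) : rc_bd R K (rc_term R [:: x]) = 0.
Proof.
rewrite rc_bd_term //= big_ord_recl big_ord0 /face /=.
by rewrite [rc_term _ _]rc_term_nongen // scaler0 addr0.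
Qed.

Lemma bd_pair (K : digraph) (x y : K) : reach x y ->
  rc_bd R K (rc_term R [:: x; y]) = rc_term R [:: y] - rc_term R [:: x].
Proof.
move=> xy; rewrite rc_bd_term /= ?xy // !big_ord_recl big_ord0 /face /=.
by rewrite expr0 expr1 scale1r scaleN1r addr0.
Qed.

Lemma homotopy_vertex i : (i < n)%N ->
  rc_bd R G (h (tb [:: i])) + h (rc_bd R G (tb [:: i])) = tb [:: i] - tb [:: 0%N].
Proof.
move=> i_n; have ci : chain n (rcons [::] i) by rewrite /chain /= ltnW.
rewrite bd_vertex linear0 addr0 -[[:: i] in LHS]/(rcons [::] i) (homotopyE R tp) //=.
  rewrite scale1r linear_sum -(telescope_sumr (fun l => tb [:: l])) //.
  apply: eq_big_nat => l /andP[_ li]; rewrite /= bd_pair //.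
  by apply: (reach_fst_le pt); lia.
by rewrite ltn_eqF.
Qed.

Lemma section_map_vertex : section_map (tc [:: 0%N]) = tb [:: 0%N].
Proof.
by rewrite section_mapE bd_vertex fill_tc // lift_tc // !linear0 !addr0 /=
  (tp_start tp).
Qed.

(** The boundary of the filling trades the pair (a_0, a_m) for the edges of [b]; [fill] vanishes on
    the two vertices in the boundary of the chord. *)
Lemma section_map_edge : section_map (tc [:: 0%N; m]) = edge_sum R b [::] 0 n.
Proof.
have c0m : chain m [:: 0%N; m] by rewrite /chain /= leqnn.
have cm : chain m [:: m] by rewrite /chain /= leqnn.
rewrite section_mapE lift_tc // bd_pair; last first.
  by apply: (reach_fst_le tq); rewrite leqnn.
rewrite linearB -[[:: c m]]/(map c [:: m]) -[[:: c 0]]/(map c [:: 0%N]).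
rewrite !fill_tc // eqxx /= ?eqseq_cons ?andbF subrr addr0.
by rewrite bd_filling addrC subrK.
Qed.

Lemma homotopyP x :
  rc_bd R G (h x) + h (rc_bd R G x) = x - section_map (fx x).
Proof.
apply: (@freemod_lin_ext _ _ _ ((rc_bd R G \o h) \+ (h \o rc_bd R G))
  (idfun \- (section_map \o fx))) => g.
pose y := freemod_gen R g; rewrite -[LHS]/(rc_bd R G (h y) + h (rc_bd R G y)).
rewrite -[RHS]/(y - section_map (fx y)) /y -rc_term_gen => {y}.
(* On tuples of [a] the prism is minus [fill], so the identity reduces to the formula for
   [section_map]. *)
have fstP t : chain m t -> rc_bd R G (h (ta t)) + h (rc_bd R G (ta t)) =
    ta t - section_map (fx (ta t)).
  move=> mt; rewrite map_f_chain // section_mapE -lift_tc //.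
  rewrite (tuple_map_bd lift_reach) !homotopy_lift linearN /=.
  by rewrite -addrA opprD addrA subrr add0r opprD.
have rg := rc_gen_reach g.
have [gB|/(all_onfst tp rg) gA] := boolP (all (onfst n b) g); last first.
  by have [t mt ->] := reach_chain tp rg gA; apply: fstP.
have [s ns gs] := reach_chain pt rg gB.
have ss : sorted ltn s by apply: (chain_strict pt) ns _; rewrite -gs; case: (g).
have : s != [::] by move: (valP g); rewrite /= gs; case: (s).
rewrite gs; case: (lastP s) ns ss => // u j; case: (lastP u) => {u} [|u i].
  rewrite -[rcons [::] j]/[:: j] => ns _ _; have [jn|] := ltnP j n.
    have fj : fx (tb [:: j]) = tc [:: 0%N] by rewrite rc_map_term //= f_snd.
    by rewrite (homotopy_vertex jn) fj section_map_vertex.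
  (* The final vertex is also [a m], so it falls under the case of [a]. *)
  case/andP: ns => _ /andP[jn _] nj; have -> : j = n by apply/eqP; rewrite eqn_leq jn.
  have := fstP [:: m]; rewrite [map a _]/= (tp_end tp); apply.
  by rewrite /chain /= leqnn.
have uE : rcons (rcons u i) j = u ++ [:: i; j] by rewrite -!cats1 -catA.
rewrite uE => nu su _.
have ij : (i < j)%N.
  by move: su; case: (u) => [|z v] /=; rewrite ?cat_path /= ?andbT // => /and3P[].
have jn : (j <= n)%N by move: nu; rewrite /chain all_cat => /and3P[_ _ /and3P[]].
rewrite (homotopy_path R tp) //; congr (_ - _).
rewrite rc_map_term; last exact: (chain_reach tp).
(* It remains to match the correction in [homotopy_path] with the image of the tuple. All positions
   below n go to [c 0], so the image is degenerate unless the tuple is (b_i, b_n), which goes to the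
   chord. *)
case: (lastP u) su {nu uE} => [_|v k su].
  rewrite [map f _]/=.
  rewrite f_snd ?(leq_trans ij) //; have [->|jn'] := eqVneq j n.
    rewrite -(tp_end tp) f_fst // -[[:: c 0; c m]]/(map c [:: 0%N; m]).
    by rewrite section_map_edge.
  rewrite f_snd ?ltn_neqAle ?jn' // [rc_term _ _](rc_term_rep R [::]).
  by rewrite linear0.
have i_n := leq_trans ij jn.
have ki : (k < i)%N.
  move: su; rewrite -cats1 -catA; case: (v) => [|z w] /=; rewrite ?cat_path /=.
    by case/andP.
  by case/and4P.
rewrite -cats1 -catA !map_cat [map f (map b [:: k])]/= [map f (map b [:: i; j])]/=.
rewrite (f_snd (ltn_trans ki i_n)) (f_snd i_n) rc_term_rep linear0.
by case: (v).
Qed.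

(** * Filtration estimates *)

Lemma tuple_length_lift x t : (0 < x)%N -> chain m (x :: t) ->
  (tuple_length (map a (x :: t)) <= tuple_length (map c (x :: t)))%N.
Proof.
elim: t x => [//|y t IH] x x0 /andP[/= /andP[xy yt] /and3P[xm ym tm]].
apply: leq_add; last by apply: IH; rewrite ?(leq_trans x0) // /chain /= yt ym.
have xym : (x <= y <= m)%N by rewrite xy.
apply: leq_trans (dist_fst_le tp xym) _.
by apply: (dist_shortcut tq) => //; rewrite x0.
Qed.

(** In a strictly increasing chain, 0 and m can be consecutive only if they are the whole chain; all
    other consecutive pairs fall under [dist_shortcut]. *)
Lemma tuple_length_chain t : chain m t -> sorted ltn t -> t != [:: 0%N; m] ->
  (tuple_length (map a t) <= tuple_length (map c t))%N.
Proof.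
case: t => [//|[|x] t mt st t0m]; last exact: tuple_length_lift.
case: t mt st t0m => [//|y t] mt st t0m.
have ym : (y <= m)%N by case/andP: mt => _ /= /andP[].
have {t0m} ym' : (y < m)%N.
  rewrite ltn_neqAle ym andbT; apply: contra t0m => /eqP e'; rewrite e'.
  case: t mt st => [//|z t] /andP[_ /allP/(_ z)].
  by rewrite !inE eqxx !orbT /= => /(_ isT) zm /and3P[_ yz _]; lia.
apply: leq_add; last first.
  apply: (@tuple_length_lift y t); first by case/andP: st.
  by apply: chain_subseq mt; exact: subseq_cons.
have ym2 : (0 <= y <= m)%N by [].
apply: leq_trans (dist_fst_le tp ym2) _.
by apply: (dist_shortcut tq) => //; rewrite ym' orbT.
Qed.

Lemma filling_fil p : m%:Z <= p -> filling \in rc_fil R G p 2.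
Proof.
move=> mp; rewrite /filling /edge_sum big_nat; apply: rpred_sum => l /andP[_ ln].
(* The triangle (b_0, b_l, b_(l+1)) has length at most l + 1 <= n <= m. *)
apply: (@rc_term_filP _ _ _ 2 m) => //=.
have := dist_fst_le pt (i := 0) (j := l).
by have := dist_fst_le pt (i := l) (j := l.+1); lia.
Qed.

Lemma face_ends t i : chain m t -> sorted ltn t ->
  take i t ++ drop i.+1 t = [:: 0%N; m] -> (i < size t)%N ->
  exists y, [/\ (0 < y)%N, (y < m)%N & t = [:: 0%N; y; m]].
Proof.
case/andP=> _ tm st ti it; have := congr1 size ti.
rewrite size_cat size_take it size_drop /= => t3.
move: tm st ti it t3; case: t => [|x [|y [|z [|w t]]]] //=; try lia.
rewrite !andbT; case: i => [|[|[|i]]] //= hm hs [e1 e2] _ _; try lia.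
by exists y; rewrite e1 e2; split=> //; lia.
Qed.

Lemma section_map_fil p k x :
  x \in rc_fil R H p k -> section_map x \in rc_fil R G p k.
Proof.
apply: linear_supported => g; rewrite -rc_term_gen.
have [t [mt st] gt] := gen_chain g; rewrite gt size_map => /andP[/eqP tk tp'].
(* The chord has positive length and goes to a sum of pairs of length at most 1. *)
have [t0m|t0m] := eqVneq t [:: 0%N; m].
  move: tk tp'; rewrite t0m => tk tp'; rewrite section_map_edge /edge_sum big_nat.
  apply: rpred_sum => l /andP[_ ln]; apply: (@rc_term_filP _ _ _ 1 1) => //=.
  - by have := dist_fst_le pt (i := l) (j := l.+1); lia.
  - by move: tk => /=; lia.
  apply: le_trans tp'; rewrite lez_nat /= addn0 dist_gt0 //.
    by apply: (reach_fst_le tq); rewrite leqnn.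
  by apply/eqP => /(tp_injl tq); lia.
have rt : sorted (@reach H) (map c t) by exact: (chain_reach (two_paths_sym tq)).
rewrite section_mapE fill_tc // (negbTE t0m) linear0 addr0 lift_tc //.
apply: rpredD.
  apply: rc_term_fil; rewrite ?size_map //.
  by apply: le_trans tp'; rewrite lez_nat tuple_length_chain.
rewrite rc_bd_term // linear_sum; apply: rpred_sum => i _.
rewrite linearZ rpredZ // map_face fill_tc; last first.
  exact: chain_subseq (subseq_remove _ _) mt.
(* A face equal to the chord forces the tuple (c_0, c_y, c_m), whose length is at least y + (m - y)
   = m, enough for the filling. *)
case: eqP => [/(face_ends mt st)[|y [y0 ym et]]|_]; last by rewrite rpred0.
  by rewrite -[size t](size_map c).
move: tk tp'; rewrite et /= => tk tp'.
have -> : k = 2 by lia.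
apply: filling_fil; apply: le_trans tp'; rewrite lez_nat.
have h1 := @dist_shortcut H m c e 0 y tq m_gt0.
have h2 := @dist_shortcut H m c e y m tq m_gt0.
by lia.
Qed.

(** The prism replaces a last step (b_i, b_j) by (b_i, b_l, b_(l+1)), of length at most l - i + 1 <=
    j - i, and [dist_snd] says that j - i is the distance replaced. The length can grow only for a
    single vertex, which goes to a sum of edges. *)
Lemma homotopy_fil p k x :
  x \in rc_fil R G p k -> h x \in rc_fil R G (p + 1) (k + 1).
Proof.
apply: linear_supported => g; rewrite -rc_term_gen.
have rg := rc_gen_reach g => /andP[/eqP gk gp].
have [gB|gB] := boolP (all (onfst n b) g); last first.
  by rewrite homotopy_off // rpred0.
have [s ns gs] := reach_chain pt rg gB; move: gk gp; rewrite gs size_map.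
case: (lastP s) ns {gs} => [_ _ _|u j nu].
  by rewrite rc_term_nongen // linear0 rpred0.
rewrite size_rcons => uk up.
have [/andP[/eqP -> /eqP ->]|ujn] := boolP ((u == [::]) && (j == n)).
  by rewrite homotopy_end rpred0.
rewrite (homotopyE R tp) //; last by rewrite negb_and in ujn.
rewrite rpredZ // /edge_sum big_nat; apply: rpred_sum => l /andP[ul lj].
have jn : (j <= n)%N by move: nu; rewrite /chain all_rcons => /and3P[].
apply: (@rc_term_filP _ _ _ (size u).+1 (tuple_length (map b (rcons u j))).+1).
- by rewrite size_map size_cat addn2.
- case: (lastP u) nu ul {uk up ujn} => [_ _|v i].
    by have := dist_fst_le pt (i := l) (j := l.+1); rewrite /=; lia.
  rewrite last_rcons => nu il.
  rewrite -!cats1 -!catA !map_cat /= !tuple_length_cat -addnS leq_add2l /= !addn0.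
  have ijn : (i <= j <= n)%N by rewrite jn andbT (leq_trans il) // ltnW.
  rewrite (dist_snd tp nm ijn).
  have := dist_fst_le pt (i := i) (j := l).
  by have := dist_fst_le pt (i := l) (j := l.+1); lia.
- by lia.
by lia.
Qed.

Definition section_filtered :
    filtered_map (reachability_complex R H) (reachability_complex R G) :=
  @FilteredMap _ (reachability_complex R H) (reachability_complex R G)
    section_map section_map_bd section_map_fil.

Lemma contraction_bij k l : bijective (PH_map R f k l).
Proof.
exact: (@homotopy_page2_bij _ _ _ (reachability_map R f) section_filtered h
  section_mapK homotopy_fil homotopyP).
Qed.

End Contraction.

(** * Bi-directed cycles *)

Section Bicycle.
Variables (m n : nat).
Hypotheses (m_gt0 : (0 < m)%N) (n_gt0 : (0 < n)%N).

Definition fst_path (i : nat) : bicycle m n :=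
  \pi_(cycle_vertex m n) (inl (inord i)).
Definition snd_path (j : nat) : bicycle m n :=
  \pi_(cycle_vertex m n) (inr (inord j)).

Lemma pi_glued (u v : two_intervals m n) :
  (\pi_(cycle_vertex m n) u = \pi_(cycle_vertex m n) v) <-> glued u v.
Proof. by split=> [/eqmodP|h] //; apply/eqmodP. Qed.

Lemma fst_pathE (i : 'I_m.+1) : fst_path i = \pi_(cycle_vertex m n) (inl i).
Proof. by rewrite /fst_path inord_val. Qed.

Lemma snd_pathE (j : 'I_n.+1) : snd_path j = \pi_(cycle_vertex m n) (inr j).
Proof. by rewrite /snd_path inord_val. Qed.

Lemma edge_path u v : @edge (bicycle m n) u v <->
  ((exists2 i, (i < m)%N & u = fst_path i /\ v = fst_path i.+1) \/
   (exists2 j, (j < n)%N & u = snd_path j /\ v = snd_path j.+1)).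
Proof.
split=> [/existsP[x /existsP[y /and3P[/eqP <- /eqP <-]]]|].
  case: x y => [i|i] [j|j] // /eqP ij; [left|right]; exists (val i).
  - by rewrite -ltnS -ij.
  - by rewrite -ij fst_pathE fst_pathE.
  - by rewrite -ltnS -ij.
  - by rewrite -ij snd_pathE snd_pathE.
case=> -[i im [-> ->]]; apply/existsP.
- exists (inl (inord i)); apply/existsP; exists (inl (inord i.+1)).
  by rewrite !eqxx /= !inordK // ltnW.
- exists (inr (inord i)); apply/existsP; exists (inr (inord i.+1)).
  by rewrite !eqxx /= !inordK // ltnW.
Qed.

Lemma bicycle_cover (x : bicycle m n) :
  (exists2 i, (i <= m)%N & x = fst_path i) \/
  (exists2 j, (j <= n)%N & x = snd_path j).
Proof.
have := reprK x; case: (repr x) => i e; [left|right]; exists (val i).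
- by rewrite -ltnS ltn_ord.
- by rewrite -e fst_pathE.
- by rewrite -ltnS ltn_ord.
- by rewrite -e snd_pathE.
Qed.

Lemma end_repr_snd j : (j <= n)%N ->
  end_repr (inr (inord j) : two_intervals m n) =
    if j == 0%N then inl ord0 else if j == n then inl ord_max else inr (inord j).
Proof. by move=> jn; rewrite /= -!val_eqE /= inordK. Qed.

Lemma two_paths_bicycle : two_paths m n fst_path snd_path.
Proof.
have pi_eq u v : \pi_(cycle_vertex m n) u = \pi_(cycle_vertex m n) v ->
    end_repr u = end_repr v by move/pi_glued/eqP.
have inl_ord (x y : 'I_m.+1) : inl x = inl y :> two_intervals m n -> x = y :> nat.
  by case=> ->.
split.
- exact: bicycle_cover.
- exact: edge_path.
- apply/pi_glued; rewrite /glued end_repr_snd // eqxx; apply/eqP.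
  by congr inl; apply: val_inj; rewrite /= inordK.
- apply/pi_glued; rewrite /glued end_repr_snd // eqxx (gtn_eqF n_gt0); apply/eqP.
  by congr inl; apply: val_inj; rewrite /= inordK.
- by move=> i i' hi hi' /pi_eq /inl_ord; rewrite !inordK.
- move=> j j' hj hj' /pi_eq; rewrite !end_repr_snd //.
  have [->|j0] := eqVneq j 0%N; have [->|j0'] := eqVneq j' 0%N => //.
  (* The ends of the second interval are represented by those of the first, which are distinct
     because m > 0. *)
  + by case: eqP => // _ /inl_ord /= e; move: m_gt0; rewrite -e.
  + by case: eqP => // _ /inl_ord /= e; move: m_gt0; rewrite e.
  case: eqP => [->|_]; case: eqP => [->|_] //.
  by case=> /(congr1 val); rewrite /= !inordK.
move=> i j hi hj /pi_eq; rewrite end_repr_snd //.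
case: eqP => [->|_]; first by move/inl_ord; rewrite inordK //; left.
by case: eqP => [->|_] //; move/inl_ord; rewrite inordK //; right.
Qed.

End Bicycle.

Lemma contract_snd_fst m n (n_gt0 : (0 < n)%N) i :
  contract_snd m n_gt0 (fst_path m n i) = fst_path m 1 i.
Proof. exact: contract_snd_funE. Qed.

Lemma contract_snd_snd m n (m_gt0 : (0 < m)%N) (n_gt0 : (0 < n)%N) j :
  (j < n)%N -> contract_snd m n_gt0 (snd_path m n j) = fst_path m 1 0%N.
Proof.
move=> jn; rewrite (tp_start (two_paths_bicycle m_gt0 (ltn0Sn 0))).
apply: etrans (contract_snd_funE n_gt0 _) _; rewrite /= inordK ?ltnS ?(ltnW jn) //.
by rewrite jn -(snd_pathE m (n := 1) ord0).
Qed.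

Lemma contract_fst_snd m n (m_gt0 : (0 < m)%N) i :
  contract_fst n m_gt0 (snd_path m n i) = fst_path n 1 i.
Proof. exact: contract_fst_funE. Qed.

Lemma contract_fst_fst m n (m_gt0 : (0 < m)%N) (n_gt0 : (0 < n)%N) i :
  (i < m)%N -> contract_fst n m_gt0 (fst_path m n i) = fst_path n 1 0%N.
Proof.
move=> im; rewrite (tp_start (two_paths_bicycle n_gt0 (ltn0Sn 0))).
apply: etrans (contract_fst_funE m_gt0 _) _; rewrite /= inordK ?ltnS ?(ltnW im) //.
by rewrite im -(snd_pathE n (n := 1) ord0).
Qed.

Lemma linear_inverse (R : pzRingType) (U V : lmodType R) (f : {linear U -> V}) :
  bijective f -> exists g : {linear V -> U}, cancel f g /\ cancel g f.
Proof.
case=> g fK gK; have lg := can2_linear fK gK.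
pose gl := GRing.isLinear.Build R V U *:%R g lg.
by exists (HB.pack_for {linear V -> U} g gl).
Qed.

Theorem proposition9p2 (R : comPzRingType) (m n : nat)
    (m_gt0 : (0 < m)%N) (n_gt0 : (0 < n)%N) :
  (forall m' n' : nat, (0 < m')%N -> (0 < n')%N -> maxn m' n' = maxn m n ->
     forall k l : int,
       exists phi : {linear PH R (bicycle m n) k l -> PH R (bicycle m' n') k l},
         bijective phi) /\
  ((n <= m)%N -> forall k l : int, bijective (PH_map R (contract_snd m n_gt0) k l)) /\
  ((m <= n)%N -> forall k l : int, bijective (PH_map R (contract_fst n m_gt0) k l)).
Proof.
have snd_bij (p q : nat) (q_gt0 : (0 < q)%N) : (q <= p)%N ->
    forall k l : int, bijective (PH_map R (contract_snd p q_gt0) k l).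
  move=> qp k l; have p_gt0 := leq_trans q_gt0 qp.
  apply: (contraction_bij R (two_paths_bicycle p_gt0 q_gt0)
    (two_paths_bicycle p_gt0 (ltn0Sn 0))) => // [i _|j].
    exact: contract_snd_fst.
  exact: contract_snd_snd.
have fst_bij (p q : nat) (p_gt0 : (0 < p)%N) : (p <= q)%N ->
    forall k l : int, bijective (PH_map R (contract_fst q p_gt0) k l).
  move=> pq k l; have q_gt0 := leq_trans p_gt0 pq.
  apply: (contraction_bij R (two_paths_sym (two_paths_bicycle p_gt0 q_gt0))
    (two_paths_bicycle q_gt0 (ltn0Sn 0))) => // [i _|j].
    exact: contract_fst_snd.
  exact: contract_fst_fst.
(* Two cycles with the same maximum are compared through the common target of their contractions. *)
have iso (p q : nat) k l : (0 < p)%N -> (0 < q)%N -> exists phi :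
    {linear PH R (bicycle p q) k l -> PH R (bicycle (maxn p q) 1) k l}, bijective phi.
  move=> p_gt0 q_gt0; have [pq|qp] := leqP p q.
    by exists (PH_map R (contract_fst q p_gt0) k l); apply: fst_bij.
  by exists (PH_map R (contract_snd p q_gt0) k l); apply: snd_bij; apply: ltnW.
split; last by split=> h k l; [apply: snd_bij | apply: fst_bij].
move=> m' n' m'_gt0 n'_gt0 mn k l.
have [phi phi_bij] := iso m n k l m_gt0 n_gt0.
have [psi /linear_inverse [psi' [psiK psi'K]]] := iso m' n' k l m'_gt0 n'_gt0.
move: psi psi' psiK psi'K; rewrite mn => psi psi' psiK psi'K.
by exists (psi' \o phi); apply: bij_comp phi_bij; exists psi.
Qed.
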